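(* Let $\mathcal{L}_3$ be the language of Boolean algebras $\{0,1,\cap,\cup,\neg\}$ expanded by unary predicates $C_n$ ($n\geq 1$), a unary predicate $Fin$, and unary predicates $Res(n,r)$ ($n,r\in\mathbb{Z}$, $n>0$). Let $T_3$ be the $\mathcal{L}_3$-theory consisting of the following axioms: (1) the axioms of Boolean algebras; the model is infinite; every nonzero element has an atom below it; for each $n\geq 1$, $C_n(x)$ holds iff there are at least $n$ distinct atoms $\alpha\leq x$; (2) $Fin$ is a proper ideal; for each $n<\omega$, $\forall x\,(\sharp(x)\leq n\Rightarrow Fin(x))$; (3) (Main Axiom) $\forall x\,(\neg Fin(x)\Rightarrow \exists y\,(y<x\wedge\neg Fin(y)\wedge\neg Fin(x-y)))$; (4) (Boolean-Presburger axioms) for all integers $n,m>0$ and $r,s$: $\forall x\,(Res(n,r)(x)\Rightarrow Fin(x))$; $\forall x\,(Fin(x)\wedge \sharp(x)=m\Rightarrow Res(n,r)(x))$ whenever $m\equiv r \pmod n$; $\forall x\,(Res(n,r)(x)\Rightarrow Res(n,s)(x))$ whenever $r\equiv s\pmod n$; $\forall x\,(Res(n,r)(x)\Rightarrow \neg Res(n,s)(x))$ whenever $r\not\equiv s\pmod n$; $\forall x\,(Res(m,r)(x)\Rightarrow Res(n,r)(x))$ whenever $n\mid m$; $\forall x\,(Fin(x)\Rightarrow \bigvee_{0\leq r<n}Res(n,r)(x))$; $\forall x\forall y\,(x\cap y=0\wedge Res(n,r)(x)\wedge Res(n,s)(y)\Rightarrow Res(n,r+s)(x\cup y))$; $\forall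 x\forall y\,(x\cap y=0\wedge Res(n,r)(x\cup y)\Rightarrow \bigvee_{0\leq s<n,\,0\leq t<n,\,s+t\equiv r \pmod n}(Res(n,s)(x)\wedge Res(n,t)(y)))$. Then $T_3$ is complete, decidable, and has quantifier elimination in $\mathcal{L}_3$. (It is the theory of the structures $Powerset(I)$, $I$ infinite, with $C_n$, $Fin$ the ideal of finite sets, and $Res(n,r)(x)$ meaning $x$ is finite with $|x|\equiv r\pmod n$.)
   Context: In a Boolean algebra, $x<y$ means $x\leq y$ and $x\neq y$, and $x-y=x\cap\neg y$. The statement ''$\sharp(x)\leq n$'' abbreviates $\neg C_{n+1}(x)$, and ''$\sharp(x)=m$'' abbreviates $C_m(x)\wedge\neg C_{m+1}(x)$ (for $m=0$, $\neg C_1(x)$); here $\sharp(x)$ is the number of atoms below $x$ (or $\infty$). $Powerset(I)$ denotes the Boolean algebra of all subsets of $I$. *)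

(* Defs.v *)
From mathcomp Require Import all_boot all_order all_algebra.
From mathcomp Require Import boolp classical_sets functions cardinality.

Set Implicit Arguments.
Unset Strict Implicit.
Unset Printing Implicit Defensive.

Import Order.TTheory GRing.Theory.

Local Open Scope nat_scope.

Definition posnat := {n : nat | 0 < n}.
Definition posnat_val (n : posnat) : nat := sval n.
Coercion posnat_val : posnat >-> nat.
Definition succ_pos (n : nat) : posnat := exist _ n.+1 isT.

Inductive term : Type :=
| tVar (i : nat)
| tZero
| tOne
| tMeet (t u : term)
| tJoin (t u : term)
| tCompl (t : term).

Inductive formula : Type :=
| fBot
| fEq (t u : term)
| fC (n : posnat) (t : term)
| fFin (t : term)
| fRes (n : posnat) (r : int) (t : term)
| fImp (a b : formula)
| fAnd (a b : formula)
| fOr (a b : formula)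
| fAll (i : nat) (a : formula)
| fEx (i : nat) (a : formula).

Coercion tVar : nat >-> term.

Definition fNot a := fImp a fBot.
Definition fTop := fNot fBot.
Definition fIff a b := fAnd (fImp a b) (fImp b a).

Declare Scope fo_scope.
Delimit Scope fo_scope with fo.
Bind Scope fo_scope with term formula.
Notation "t ∩ u" := (tMeet t u) (at level 40, left associativity) : fo_scope.
Notation "t ∪ u" := (tJoin t u) (at level 50, left associativity) : fo_scope.
Notation "t ≐ u" := (fEq t u) (at level 70, no associativity) : fo_scope.
Notation "¬ a" := (fNot a) (at level 75, right associativity) : fo_scope.
Notation "a ∧ b" := (fAnd a b) (at level 80, right associativity) : fo_scope.
Notation "a ∨ b" := (fOr a b) (at level 85, right associativity) : fo_scope.
Notation "a ⇒ b" := (fImp a b)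
  (at level 90, b at level 200, right associativity) : fo_scope.
Notation "a ⇔ b" := (fIff a b) (at level 95, no associativity) : fo_scope.
Notation "∀ i , a" := (fAll i a) (at level 200, a at level 200) : fo_scope.
Notation "∃ i , a" := (fEx i a) (at level 200, a at level 200) : fo_scope.
Notation "⋀_ ( i < n | P ) a" := (\big[fAnd/fTop]_(i < n | P) a)
  (at level 35, i, n at level 50, a at level 35) : fo_scope.
Notation "⋀_ ( i < n ) a" := (\big[fAnd/fTop]_(i < n) a)
  (at level 35, i, n at level 50, a at level 35) : fo_scope.
Notation "⋁_ ( i < n | P ) a" := (\big[fOr/fBot]_(i < n | P) a)
  (at level 35, i, n at level 50, a at level 35) : fo_scope.
Notation "⋁_ ( i < n ) a" := (\big[fOr/fBot]_(i < n) a)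
  (at level 35, i, n at level 50, a at level 35) : fo_scope.

Fixpoint occurs (i : nat) (t : term) : bool :=
  match t with
  | tVar j => i == j
  | tZero | tOne => false
  | tMeet t u | tJoin t u => occurs i t || occurs i u
  | tCompl t => occurs i t
  end.

Fixpoint free_in (i : nat) (a : formula) : bool :=
  match a with
  | fBot => false
  | fEq t u => occurs i t || occurs i u
  | fC _ t | fFin t | fRes _ _ t => occurs i t
  | fImp a b | fAnd a b | fOr a b => free_in i a || free_in i b
  | fAll j a | fEx j a => (i != j) && free_in i a
  end.

Definition sentence (a : formula) : Prop := forall i, ~~ free_in i a.

Fixpoint quantifier_free (a : formula) : bool :=
  match a with
  | fBot | fEq _ _ | fC _ _ | fFin _ | fRes _ _ _ => true
  | fImp a b | fAnd a b | fOr a b => quantifier_free a && quantifier_free b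
  | fAll _ _ | fEx _ _ => false
  end.

Record structure := Structure {
  dom :> Type;
  iZero : dom;
  iOne : dom;
  iMeet : dom -> dom -> dom;
  iJoin : dom -> dom -> dom;
  iCompl : dom -> dom;
  iC : posnat -> dom -> Prop;
  iFin : dom -> Prop;
  iRes : posnat -> int -> dom -> Prop }.

Definition update (M : Type) (v : nat -> M) (i : nat) (d : M) : nat -> M :=
  fun j => if j == i then d else v j.

Fixpoint eval (M : structure) (v : nat -> M) (t : term) : M :=
  match t with
  | tVar i => v i
  | tZero => iZero M
  | tOne => iOne M
  | tMeet t u => iMeet (eval v t) (eval v u)
  | tJoin t u => iJoin (eval v t) (eval v u)
  | tCompl t => iCompl (eval v t)
  end.

Fixpoint sat (M : structure) (v : nat -> M) (a : formula) : Prop :=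
  match a with
  | fBot => False
  | fEq t u => eval v t = eval v u
  | fC n t => iC n (eval v t)
  | fFin t => iFin (eval v t)
  | fRes n r t => iRes n r (eval v t)
  | fImp a b => sat v a -> sat v b
  | fAnd a b => sat v a /\ sat v b
  | fOr a b => sat v a \/ sat v b
  | fAll i a => forall d : M, sat (update v i d) a
  | fEx i a => exists d : M, sat (update v i d) a
  end.

Definition holds (M : structure) (a : formula) : Prop :=
  forall v : nat -> M, sat v a.

Definition theory := set formula.

Definition models (M : structure) (T : theory) : Prop :=
  forall a, T a -> holds M a.

Definition entails (T : theory) (a : formula) : Prop :=
  forall M, models M T -> holds M a.

Definition complete (T : theory) : Prop :=
  (exists M, models M T) /\
  forall a, sentence a -> entails T a \/ entails T (fNot a).

Definition quantifier_elimination (T : theory) : Prop :=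
  forall a, exists b,
    [/\ quantifier_free b,
        forall i, free_in i b -> free_in i a
      & entails T (fIff a b)].

(** The general recursive functions: [recursive_min] is minimization of a
    regular function, so all members of the class are total. *)
Inductive recursive : forall k, (k.-tuple nat -> nat) -> Prop :=
| recursive_zero k :
    recursive (fun _ : k.-tuple nat => 0)
| recursive_succ :
    recursive (fun v : 1.-tuple nat => (thead v).+1)
| recursive_proj k (i : 'I_k) :
    recursive (fun v : k.-tuple nat => tnth v i)
| recursive_comp k m (f : m.-tuple nat -> nat)
    (g : 'I_m -> k.-tuple nat -> nat) :
    recursive f -> (forall i, recursive (g i)) ->
    recursive (fun v : k.-tuple nat => f [tuple g i v | i < m])
| recursive_prec k (f : k.-tuple nat -> nat) (g : k.+2.-tuple nat -> nat) :
    recursive f -> recursive g ->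
    recursive (fun v : k.+1.-tuple nat =>
      iteri (thead v)
        (fun i r => g [tuple of i :: r :: behead v])
        (f [tuple of behead v]))
| recursive_min k (f : k.+1.-tuple nat -> nat)
    (regular : forall v : k.-tuple nat, exists y, f [tuple of y :: v] == 0) :
    recursive f ->
    recursive (fun v : k.-tuple nat => ex_minn (regular v)).

Definition recursive_set (A : set nat) : Prop :=
  recursive (fun v : 1.-tuple nat => nat_of_bool `[< A (thead v) >]).

(** Goedel numbers; [CodeSeq.code : seq nat -> nat] is a bijection. *)
Definition goedel_int (r : int) : nat :=
  match r with
  | Posz n => CodeSeq.code [:: 0; n]
  | Negz n => CodeSeq.code [:: 1; n]
  end.

Fixpoint goedel_term (t : term) : nat :=
  match t with
  | tVar i => CodeSeq.code [:: 0; i]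
  | tZero => CodeSeq.code [:: 1]
  | tOne => CodeSeq.code [:: 2]
  | tMeet t u => CodeSeq.code [:: 3; goedel_term t; goedel_term u]
  | tJoin t u => CodeSeq.code [:: 4; goedel_term t; goedel_term u]
  | tCompl t => CodeSeq.code [:: 5; goedel_term t]
  end.

Fixpoint goedel (a : formula) : nat :=
  match a with
  | fBot => CodeSeq.code [:: 0]
  | fEq t u => CodeSeq.code [:: 1; goedel_term t; goedel_term u]
  | fC n t => CodeSeq.code [:: 2; posnat_val n; goedel_term t]
  | fFin t => CodeSeq.code [:: 3; goedel_term t]
  | fRes n r t =>
      CodeSeq.code [:: 4; posnat_val n; goedel_int r; goedel_term t]
  | fImp a b => CodeSeq.code [:: 5; goedel a; goedel b]
  | fAnd a b => CodeSeq.code [:: 6; goedel a; goedel b]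
  | fOr a b => CodeSeq.code [:: 7; goedel a; goedel b]
  | fAll i a => CodeSeq.code [:: 8; i; goedel a]
  | fEx i a => CodeSeq.code [:: 9; i; goedel a]
  end.

Definition decidable_theory (T : theory) : Prop :=
  recursive_set
    [set n | exists a, [/\ sentence a, entails T a & n = goedel a]].

Section T3.

Local Open Scope fo_scope.

Local Notation x := 0%N.
Local Notation y := 1%N.
Local Notation z := 2%N.

Definition fLe (t u : term) : formula := t ∩ u ≐ t.
Definition fLt (t u : term) : formula := fLe t u ∧ ¬ (t ≐ u).
Definition tDiff (t u : term) : term := t ∩ tCompl u.

(** The variable [i] denotes an atom; the bound variable [i.+1] is fresh. *)
Definition fAtom (i : nat) : formula :=
  ¬ (i ≐ tZero) ∧
  (∀ i.+1, fLe i.+1 i ⇒ i.+1 ≐ tZero ∨ i.+1 ≐ i).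

Definition fExs (i n : nat) (a : formula) : formula :=
  foldr fEx a (iota i n).

(** Distinctness of the [n] variables [i, ..., i + n - 1], the ones bound by
    [fExs i n]. *)
Definition fDistinct (i n : nat) : formula :=
  ⋀_(j < n) ⋀_(k < n | (j < k)%N) (¬ ((i + j)%N ≐ (i + k)%N)).

(** [fCardLe t n] is "at most [n] atoms below [t]", [fCardEq t m] "exactly
    [m]". *)
Definition fCardLe (t : term) (n : nat) : formula := ¬ fC (succ_pos n) t.
Definition fCardEq (t : term) (m : posnat) : formula :=
  fC m t ∧ ¬ fC (succ_pos m) t.

Inductive T3 : theory :=
| ax_meetC : T3 (∀ x, ∀ y, x ∩ y ≐ y ∩ x)
| ax_joinC : T3 (∀ x, ∀ y, x ∪ y ≐ y ∪ x)
| ax_meetA : T3 (∀ x, ∀ y, ∀ z, x ∩ (y ∩ z) ≐ (x ∩ y) ∩ z)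
| ax_joinA : T3 (∀ x, ∀ y, ∀ z, x ∪ (y ∪ z) ≐ (x ∪ y) ∪ z)
| ax_meetK : T3 (∀ x, ∀ y, x ∩ (x ∪ y) ≐ x)
| ax_joinK : T3 (∀ x, ∀ y, x ∪ (x ∩ y) ≐ x)
| ax_meetD : T3 (∀ x, ∀ y, ∀ z, x ∩ (y ∪ z) ≐ (x ∩ y) ∪ (x ∩ z))
| ax_joinD : T3 (∀ x, ∀ y, ∀ z, x ∪ (y ∩ z) ≐ (x ∪ y) ∩ (x ∪ z))
| ax_meetN : T3 (∀ x, x ∩ tCompl x ≐ tZero)
| ax_joinN : T3 (∀ x, x ∪ tCompl x ≐ tOne)
| ax_infinite (n : nat) : T3 (fExs 0 n (fDistinct 0 n))
| ax_atomic : T3 (∀ x, ¬ (x ≐ tZero) ⇒ ∃ y, fAtom y ∧ fLe y x)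
| ax_C (n : posnat) :
    T3 (∀ x, fC n x ⇔
          fExs 1 n ((⋀_(j < n) (fAtom (1 + j)%N ∧ fLe (1 + j)%N x))
                    ∧ fDistinct 1 n))
| ax_Fin0 : T3 (fFin tZero)
| ax_Fin_down : T3 (∀ x, ∀ y, fFin x ∧ fLe y x ⇒ fFin y)
| ax_Fin_join : T3 (∀ x, ∀ y, fFin x ∧ fFin y ⇒ fFin (x ∪ y))
| ax_Fin_proper : T3 (¬ fFin tOne)
| ax_Fin_card (n : nat) : T3 (∀ x, fCardLe x n ⇒ fFin x)
| ax_main :
    T3 (∀ x, ¬ fFin x ⇒ ∃ y, fLt y x ∧ ¬ fFin y ∧ ¬ fFin (tDiff x y))
| ax_Res_Fin (n : posnat) (r : int) : T3 (∀ x, fRes n r x ⇒ fFin x)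
| ax_Res_card (n m : posnat) (r : int) : (m = r %[mod n])%Z ->
    T3 (∀ x, fFin x ∧ fCardEq x m ⇒ fRes n r x)
| ax_Res_cong (n : posnat) (r s : int) : (r = s %[mod n])%Z ->
    T3 (∀ x, fRes n r x ⇒ fRes n s x)
| ax_Res_disj (n : posnat) (r s : int) : (r <> s %[mod n])%Z ->
    T3 (∀ x, fRes n r x ⇒ ¬ fRes n s x)
| ax_Res_dvd (n m : posnat) (r : int) : n %| m ->
    T3 (∀ x, fRes m r x ⇒ fRes n r x)
| ax_Res_total (n : posnat) :
    T3 (∀ x, fFin x ⇒ ⋁_(r < n) fRes n r x)
| ax_Res_join (n : posnat) (r s : int) :
    T3 (∀ x, ∀ y, x ∩ y ≐ tZero ∧ fRes n r x ∧ fRes n s y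
          ⇒ fRes n (r + s)%R (x ∪ y))
| ax_Res_split (n : posnat) (r : int) :
    T3 (∀ x, ∀ y, x ∩ y ≐ tZero ∧ fRes n r (x ∪ y)
          ⇒ ⋁_(s < n) ⋁_(t < n | ((s + t)%N == r %[mod n])%Z)
              (fRes n s x ∧ fRes n t y)).

End T3.

Section Powerset.

Local Open Scope classical_set_scope.
Local Open Scope card_scope.

Definition Powerset (I : Type) : structure := {|
  dom := set I;
  iZero := set0;
  iOne := setT;
  iMeet := @setI I;
  iJoin := @setU I;
  iCompl := @setC I;
  iC := fun n A => `I_n #<= A;
  iFin := fun A => finite_set A;
  iRes := fun n r A => exists k : nat, A #= `I_k /\ (k = r %[mod n])%Z |}.

End Powerset.

(* Main.v *)
From HB Require Import structures.
Require Import Defs.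
From mathcomp Require Import all_boot all_order all_algebra.
From mathcomp Require Import boolp classical_sets functions cardinality.
From mathcomp Require Import zify.

(** Below a fixed precision, an element of a model of [T3] is described by an
    extended cardinal: a natural number if it is in [Fin] (counted exactly up to
    a threshold, and modulo [m`!] beyond it), infinity otherwise.  A valuation
    of [m] variables is then described by the extended cardinals of the [2 ^ m]
    cells it cuts out, and choosing a value for one more variable amounts to
    splitting each cell.  When the threshold for the cell exceeds twice that for
    the parts plus twice the modulus, the splittings realized in the model are
    exactly the splittings of the extended cardinal ([osim_split],
    [osim_merge]), the Main Axiom being the case infinity = infinity + infinity.
    Hence the truth of a formula in any model is computed by a recursion [ev]
    over finitely many descriptions.  This gives completeness, quantifier
    elimination (a formula is a disjunction of descriptions of its variables)
    and, since [ev] is recursive on codes, decidability. *)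

(** The obstacle is that a model may be nonstandard: an element of [Fin] can have infinitely many
    atoms, and then only its residues distinguish it. Such an element has many descriptions, so a
    cell determines its code only up to the current precision. Two choices make the recursion
    uniform and finite. One parameter [m] bounds the variables, the indices of [C] and [Res] and the
    quantifier depth; the Goedel number of the formula is such a bound, and [m!] is a common
    multiple of all moduli in play. Next, infinity splits as infinity plus any finite cardinal, so
    these splittings are capped at [N + D], with [N] the precision still needed and [D] the modulus:
    every element of [Fin] has a representative below that value. A large finite cell is not reduced
    in this way, because its parts must add up to it exactly; as two cells are merged before being
    split again, entries at most double at each quantifier, and [state_bound] allows for this. *)

Set Implicit Arguments.
Unset Strict Implicit.
Unset Printing Implicit Defensive.

Local Open Scope nat_scope.

(** * Recursive functions *)

(* Functions of finitely many entries of an infinite environment: adding a bound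
   variable then shifts indices, and no arity has to be tracked. *)
Definition env_rec (f : (nat -> nat) -> nat) : Prop :=
  exists k (g : k.-tuple nat -> nat),
    recursive g /\ forall e, f e = g [tuple e i | i < k].

Lemma recursive_ext k (f g : k.-tuple nat -> nat) :
  f =1 g -> recursive f -> recursive g.
Proof. by move=> /funext ->. Qed.

Lemma recursive_widen k k' (g : k.-tuple nat -> nat) (lekk' : k <= k') :
  recursive g ->
  recursive (fun v : k'.-tuple nat => g [tuple tnth v (widen_ord lekk' i) | i <
    k]).
Proof. by move=> rg; apply: recursive_comp => // i; apply: recursive_proj. Qed.

(** Raising the arity at will lets finitely many functions share one arity, as composition and
    primitive recursion require. *)
Lemma env_recP f : env_rec f ->
  exists k0, forall k, k0 <= k ->
    exists2 g : k.-tuple nat -> nat,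
      recursive g & forall e, f e = g [tuple e i | i < k].
Proof.
move=> [k0 [g [rg fg]]]; exists k0 => k le_k; eexists.
  exact: (recursive_widen le_k rg).
move=> e; rewrite fg; congr g; apply: eq_from_tnth => i.
by rewrite !tnth_mktuple.
Qed.

Lemma env_rec_ext f g : (forall e, f e = g e) -> env_rec f -> env_rec g.
Proof. by move=> /funext ->. Qed.

Lemma env_rec_var i : env_rec (fun e => e i).
Proof.
exists i.+1, (fun v => tnth v ord_max); split; first exact: recursive_proj.
by move=> e; rewrite tnth_mktuple.
Qed.

Lemma env_rec0 : env_rec (fun=> 0).
Proof. by exists 0, (fun=> 0); split=> //; apply: recursive_zero. Qed.

Lemma env_rec_comp f (g : nat -> (nat -> nat) -> nat) :
  env_rec f -> (forall i, env_rec (g i)) -> env_rec (fun e => f (fun i => g i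
    e)).
Proof.
move=> [k [h [rh fh]]] rg.
have /choice[b bP] i := env_recP (rg i).
pose K := \max_(i < k) b i.
have leK (i : 'I_k) : b i <= K by apply: leq_bigmax.
have /choice[c cP] (i : 'I_k) : exists c : K.-tuple nat -> nat,
    recursive c /\ forall e, g i e = c [tuple e j | j < K].
  by have [c rc ce] := bP i K (leK i); exists c.
exists K, (fun v => h [tuple c i v | i < k]); split.
  by apply: recursive_comp => // i; have [] := cP i.
move=> e; rewrite fh; congr h; apply: eq_from_tnth => i.
by rewrite !tnth_mktuple; have [_ ->] := cP i.
Qed.

Definition scons (x : nat) (e : nat -> nat) : nat -> nat :=
  fun i => if i is j.+1 then e j else x.

Lemma env_rec_comp1 f A : env_rec f -> env_rec A ->
  env_rec (fun e => f (scons (A e) e)).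
Proof.
move=> rf rA; pose g i := if i is j.+1 then (fun e : nat -> nat => e j) else A.
apply: env_rec_ext (env_rec_comp (g := g) rf _).
  by move=> e; congr f; apply: funext => -[].
by case=> //= j; apply: env_rec_var.
Qed.

Definition rec1 (f : nat -> nat) := env_rec (fun e => f (e 0)).
Definition rec2 (f : nat -> nat -> nat) := env_rec (fun e => f (e 0) (e 1)).
Definition rec3 (f : nat -> nat -> nat -> nat) :=
  env_rec (fun e => f (e 0) (e 1) (e 2)).
Lemma env_rec_app1 f A : rec1 f -> env_rec A -> env_rec (fun e => f (A e)).
Proof. by move=> rf rA; apply: (env_rec_comp (g := fun=> A) rf). Qed.

Lemma env_rec_app2 f A B : rec2 f -> env_rec A -> env_rec B ->
  env_rec (fun e => f (A e) (B e)).
Proof.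
by move=> rf rA rB; apply: (env_rec_comp (g := nth A [:: A;
  B]) rf) => -[|[|[]]].
Qed.

Lemma env_rec_app3 f A B C : rec3 f -> env_rec A -> env_rec B -> env_rec C ->
  env_rec (fun e => f (A e) (B e) (C e)).
Proof.
move=> rf rA rB rC.
by apply: (env_rec_comp (g := nth A [:: A; B; C]) rf) => -[|[|[|[]]]].
Qed.

Lemma env_rec_iteri N A F :
  env_rec N -> env_rec A ->
  env_rec (fun e => F (e 0) (e 1) (fun i => e i.+2)) ->
  env_rec (fun e => iteri (N e) (fun i r => F i r e) (A e)).
Proof.
move=> rN /env_recP[kA hA] /env_recP[kF hF]; pose k := maxn kA kF.
have [a ra Aa] := hA k (leq_maxl _ _).
have [f rf Ff] := hF k.+2 (leqW (leqW (leq_maxr _ _))).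
(* Primitive recursion runs on the head of the tuple, so the number of iterations is first read from
   entry 0 and [N] is substituted afterwards. *)
pose h e := iteri (e 0) (fun i r => F i r (fun i => e i.+1)) (A (fun i => e
  i.+1)).
suff rh : env_rec h by apply: env_rec_ext (env_rec_comp1 rh rN).
exists k.+1; eexists; split; first exact: (recursive_prec ra rf).
move=> e; rewrite /h Aa /thead tnth_mktuple; congr iteri.
  apply/funext => i; apply/funext => r.
  have := Ff (scons i (scons r (fun i => e i.+1))); rewrite /= => ->; congr f.
  apply: val_inj => /=; rewrite enum_ordSl /= enum_ordSl /= -!map_comp.
  by congr [:: _, _ & _]; apply: eq_map.
by congr a; apply: val_inj; rewrite /= enum_ordSl /= -map_comp.
Qed.

(** A recursive graph makes a function recursive by minimization: [f e] is the only zero of [1 - P].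
    Division and the decoding of sequences are obtained in this way. *)
Lemma env_rec_graph (P : nat -> (nat -> nat) -> bool) f :
  env_rec (fun e => P (e 0) (fun i => e i.+1)) ->
  (forall e, P (f e) e) -> (forall e y, P y e -> y = f e) -> env_rec f.
Proof.
move=> rP Pf Puniq.
have rneg : rec1 (fun n => 1 - n).
  apply: env_rec_ext (_ : env_rec (fun e => iteri (e 0) (fun _ _ => 0) 1)).
    by move=> e; case: (e 0).
  have r1 : env_rec (fun=> 1).
    exists 0, (fun=> 1); split=> //.
    apply: recursive_ext (recursive_comp recursive_succ (fun=> recursive_zero
      0)).
    by move=> v; rewrite /thead tnth_mktuple.
  by apply: env_rec_iteri; [apply: env_rec_var|apply: r1|apply: env_rec0].
have {rneg}/env_recP[k /(_ k.+1 (leqnSn k))[h rh hE]] := env_rec_app1 rneg rP.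
have ext e e' : (forall i, i < k -> e i = e' i) -> forall y, P y e = P y e'.
  move=> ee' y; have := hE (scons y e); have := hE (scons y e') => /=.
  set u := [tuple _ | _ < _]; set u' := [tuple _ | _ < _].
  have -> : u' = u.
    by apply: eq_from_tnth => -[[|i] lti]; rewrite !tnth_mktuple //= ee'.
  by move=> <-; case: (P y e) (P y e') => -[].
have reg (v : k.-tuple nat) : exists y, h [tuple of y :: v] == 0.
  (* A tuple is completed by zeros to an environment, so that totality of [f] gives regularity at
     every tuple. *)
  exists (f (nth 0 v)).
  have := hE (scons (f (nth 0 v)) (nth 0 v)); rewrite /= Pf => h0.
  rewrite [X in h X](_ : _ = [tuple scons (f (nth 0 v)) (nth 0 v) i | i <
    k.+1]).
    by rewrite -h0.
  apply: eq_from_tnth => -[[|i] lti]; rewrite tnth_mktuple //.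
  by rewrite (tnth_nth 0).
exists k, (fun v => ex_minn (reg v)); split; first exact: recursive_min.
move=> e; case: ex_minnP => y hy _; symmetry; apply: Puniq.
have := hE (scons y e); rewrite /= => h0.
rewrite [X in h X](_ : _ = [tuple scons y e i | i < k.+1]) in hy.
  by rewrite -h0 in hy; case: (P y e) hy.
apply: eq_from_tnth => -[[|i] lti]; rewrite tnth_mktuple // (tnth_nth 0) /=.
have lti' : i < k by [].
by have := tnth_mktuple e (Ordinal lti'); rewrite (tnth_nth 0).
Qed.

Lemma rec_succ : rec1 succn.
Proof.
exists 1, (fun v => (thead v).+1); split; first exact: recursive_succ.
by move=> e; rewrite /thead tnth_mktuple.
Qed.

Lemma env_rec_const c : env_rec (fun=> c).
Proof. by elim: c => [|c /(env_rec_app1 rec_succ)]; first exact: env_rec0. Qed.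

Lemma rec_add : rec2 addn.
Proof.
apply: env_rec_ext (_ : env_rec (fun e => iteri (e 0) (fun _ r => r.+1) (e 1))).
  by move=> e; elim: (e 0) => //= n ->.
apply: env_rec_iteri; do ?exact: env_rec_var.
by apply: (env_rec_app1 rec_succ); apply: env_rec_var.
Qed.

Lemma rec_mul : rec2 muln.
Proof.
apply: env_rec_ext (_ : env_rec (fun e => iteri (e 0) (fun _ r => e 1 + r) 0)).
  by move=> e; elim: (e 0) => //= n ->; rewrite mulSn.
apply: (env_rec_iteri (F := fun _ r e => e 1 + r));
  [exact: env_rec_var|exact: env_rec0|].
by apply: (env_rec_app2 rec_add); apply: env_rec_var.
Qed.

Lemma rec_pred : rec1 predn.
Proof.
apply: env_rec_ext (_ : env_rec (fun e => iteri (e 0) (fun i _ => i) 0)).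
  by move=> e; case: (e 0).
by apply: env_rec_iteri; [exact: env_rec_var|exact: env_rec0|exact:
  env_rec_var].
Qed.

Lemma rec_sub : rec2 subn.
Proof.
apply: env_rec_ext (_ : env_rec (fun e => iteri (e 1) (fun _ r => r.-1) (e 0))).
  by move=> e; elim: (e 1) => [|n /= ->]; rewrite ?subn0 ?subnS.
apply: env_rec_iteri; do ?exact: env_rec_var.
by apply: (env_rec_app1 rec_pred); apply: env_rec_var.
Qed.

Lemma rec_exp : rec2 expn.
Proof.
apply: env_rec_ext (_ : env_rec (fun e => iteri (e 1) (fun _ r => e 0 * r) 1)).
  by move=> e; elim: (e 1) => //= n ->; rewrite expnS.
apply: (env_rec_iteri (F := fun _ r e => e 0 * r));
  [exact: env_rec_var|exact: env_rec_const|].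
by apply: (env_rec_app2 rec_mul); apply: env_rec_var.
Qed.

Lemma env_rec_neg (P : _ -> bool) : env_rec P -> env_rec (fun e => ~~ P e).
Proof.
move=> rP; apply: env_rec_ext (_ : env_rec (fun e => 1 - P e)).
  by move=> e; case: (P e).
by apply: (env_rec_app2 rec_sub) => //; apply: env_rec_const.
Qed.

Lemma env_rec_and (P Q : _ -> bool) :
  env_rec P -> env_rec Q -> env_rec (fun e => P e && Q e).
Proof.
move=> rP rQ; apply: env_rec_ext (env_rec_app2 rec_mul rP rQ) => e.
by case: (P e) (Q e) => -[].
Qed.

Lemma env_rec_or (P Q : _ -> bool) :
  env_rec P -> env_rec Q -> env_rec (fun e => P e || Q e).
Proof.
move=> rP rQ; apply: env_rec_ext (env_rec_neg (env_rec_and (env_rec_neg rP)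
  (env_rec_neg rQ))) => e.
by rewrite negb_and !negbK.
Qed.

Lemma env_rec_imp (P Q : _ -> bool) :
  env_rec P -> env_rec Q -> env_rec (fun e => P e ==> Q e).
Proof.
move=> rP rQ; apply: env_rec_ext (env_rec_or (env_rec_neg rP) rQ) => e.
by rewrite implybE.
Qed.

Lemma env_rec_eq0 A : env_rec A -> env_rec (fun e => A e == 0).
Proof.
move=> rA; apply: env_rec_ext (_ : env_rec (fun e => 1 - A e)).
  by move=> e; case: (A e).
by apply: (env_rec_app2 rec_sub) => //; apply: env_rec_const.
Qed.

Lemma env_rec_leq A B : env_rec A -> env_rec B -> env_rec (fun e => A e <= B e).
Proof. by move=> rA rB; apply: env_rec_eq0; apply: (env_rec_app2 rec_sub). Qed.

Lemma env_rec_eq A B : env_rec A -> env_rec B -> env_rec (fun e => A e == B e).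
Proof.
move=> rA rB.
apply: env_rec_ext (env_rec_and (env_rec_leq rA rB) (env_rec_leq rB rA)) => e.
by rewrite eqn_leq.
Qed.

Lemma env_rec_big op idx N F : rec2 op -> associative op ->
  left_id idx op -> right_id idx op -> env_rec N ->
  env_rec (fun e => F (e 0) (fun i => e i.+1)) ->
  env_rec (fun e => \big[op/idx]_(i < N e) F i e).
Proof.
move=> rop opA op1x opx1 rN rF.
pose lw := Monoid.isLaw.Build nat idx op opA op1x opx1.
pose law : Monoid.law idx := HB.pack op lw.
apply: env_rec_ext (_ : env_rec (fun e => iteri (N e) (fun i r => op r (F i e))
  idx)).
  move=> e; elim: (N e) => [|n IHn]; first by rewrite big_ord0.
  by rewrite (big_ord_recr (op := law)) /= IHn.
apply: (env_rec_iteri (F := fun i r e => op r (F i e))) => //.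
  exact: env_rec_const.
apply: (env_rec_app2 rop); first exact: env_rec_var.
apply: (env_rec_comp (g := fun j e => if j is j'.+1 then e j'.+2 else e 0) rF).
by case=> [|j]; apply: env_rec_var.
Qed.

Lemma env_rec_all (P : nat -> _ -> bool) N :
  env_rec N -> env_rec (fun e => P (e 0) (fun i => e i.+1)) ->
  env_rec (fun e => all (fun x => P x e) (iota 0 (N e))).
Proof.
move=> rN rP.
apply: env_rec_ext
  (_ : env_rec (fun e => iteri (N e) (fun i r => P i e * r) 1)).
  move=> e; elim: (N e) => // n IHn.
  have -> : iota 0 n.+1 = iota 0 n ++ [:: n] by rewrite -addn1 iotaD.
  by rewrite all_cat /= IHn andbT; case: all; case: (P n e).
apply: (env_rec_iteri (F := fun i r e => P i e * r)) => //.
  exact: env_rec_const.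
apply: (env_rec_app2 rec_mul); last exact: env_rec_var.
apply: (env_rec_comp (g := fun j e => if j is j'.+1 then e j'.+2 else e 0) rP).
by case=> [|j]; apply: env_rec_var.
Qed.

Lemma env_rec_has (P : nat -> _ -> bool) N :
  env_rec N -> env_rec (fun e => P (e 0) (fun i => e i.+1)) ->
  env_rec (fun e => has (fun x => P x e) (iota 0 (N e))).
Proof.
move=> rN rP; apply: env_rec_ext (env_rec_neg
  (env_rec_all (P := fun x e => ~~ P x e) rN (env_rec_neg rP))) => e.
by rewrite -[has _ _]negbK -all_predC.
Qed.

Lemma env_rec_code_cons A (s : _ -> seq nat) :
  env_rec A -> env_rec (fun e => CodeSeq.code (s e)) ->
  env_rec (fun e => CodeSeq.code (A e :: s e)).
Proof.
move=> rA rs.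
(* [CodeSeq.code] sends [x :: s] to [2 ^ x * (CodeSeq.code s).*2.+1], which is arithmetic in [x] and
   the code of [s]. *)
apply: env_rec_ext (_ : env_rec (fun e =>
  2 ^ A e * (CodeSeq.code (s e) + CodeSeq.code (s e)).+1)).
  by move=> e; rewrite addnn.
apply: (env_rec_app2 rec_mul).
  by apply: (env_rec_app2 rec_exp) => //; apply: env_rec_const.
by apply: (env_rec_app1 rec_succ); apply: (env_rec_app2 rec_add).
Qed.

Create HintDb env_rec.

(* Proves [env_rec (fun e => t)] by recursion on [t]; functions are looked up in
   the hint database [env_rec]. *)
Ltac env_rec_step :=
  cbv beta;
  lazymatch goal with
  | |- env_rec (fun e => e ?i) => exact: env_rec_var
  | |- env_rec (fun=> ?c) => exact: env_rec_const
  | |- env_rec (fun e => nat_of_bool (~~ @?P e)) => apply: (@env_rec_neg P)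
  | |- env_rec (fun e => nat_of_bool (@?P e && @?Q e)) =>
      apply: (@env_rec_and P Q)
  | |- env_rec (fun e => nat_of_bool (@?P e || @?Q e)) =>
      apply: (@env_rec_or P Q)
  | |- env_rec (fun e => nat_of_bool (@?P e ==> @?Q e)) =>
      apply: (@env_rec_imp P Q)
  | |- env_rec (fun e => nat_of_bool (@?A e == @?B e)) =>
      apply: (@env_rec_eq A B)
  | |- env_rec (fun e => nat_of_bool (@?A e <= @?B e)) =>
      apply: (@env_rec_leq A B)
  | |- env_rec (fun e => nat_of_bool (all (@?P e) (iota 0 (@?N e)))) =>
      let Q := constr:(fun x e => P e x) in refine (@env_rec_all Q N _ _)
  | |- env_rec (fun e => nat_of_bool (has (@?P e) (iota 0 (@?N e)))) =>
      let Q := constr:(fun x e => P e x) in refine (@env_rec_has Q N _ _)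
  | |- env_rec (fun e => CodeSeq.code (@?A e :: @?s e)) =>
      apply: (@env_rec_code_cons A s)
  | |- env_rec (fun e => nat_of_bool (?f (@?A e) (@?B e))) =>
      let g := constr:(fun x y => nat_of_bool (f x y)) in
      apply: (@env_rec_app2 g A B); first by auto with env_rec
  | |- env_rec (fun e => ?f (@?A e) (@?B e) (@?C e)) =>
      apply: (@env_rec_app3 f A B C); first by auto with env_rec
  | |- env_rec (fun e => ?f (@?A e) (@?B e)) =>
      apply: (@env_rec_app2 f A B); first by auto with env_rec
  | |- env_rec (fun e => ?f (@?A e)) =>
      apply: (@env_rec_app1 f A); first by auto with env_rec
  end.
Ltac env_rec := repeat env_rec_step.

#[local] Hint Resolve rec_succ rec_pred rec_add rec_sub rec_mul rec_exp :
  env_rec.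

Lemma rec_div : rec2 divn.
Proof.
apply: (@env_rec_graph (fun q e =>
  if e 1 == 0 then q == 0 else (q * e 1 <= e 0) && (e 0 < q.+1 * e 1))).
- rewrite (_ : (fun e => _) = fun e => nat_of_bool (
    ((e 2 == 0) ==> (e 0 == 0)) && ((e 2 != 0) ==>
    ((e 0 * e 2 <= e 1) && (e 1 < (e 0).+1 * e 2))))); first by env_rec.
  by apply: funext => e; case: (e 2 == 0); rewrite ?andbT.
- move=> e; case: eqP => [->|/eqP]; first by rewrite divn0.
  by rewrite -lt0n => e1; rewrite leq_divM ltn_ceil.
move=> e q; case: eqP => [->/eqP->|/eqP]; first by rewrite divn0.
rewrite -lt0n => e1 /andP[le_q lt_q]; apply/eqP.
by rewrite eqn_leq leq_divRL // le_q -ltnS ltn_divLR.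
Qed.

#[local] Hint Resolve rec_div : env_rec.

Lemma rec_mod : rec2 modn.
Proof.
apply: env_rec_ext (_ : env_rec (fun e => e 0 - (e 0 %/ e 1) * e 1)).
  by move=> e; rewrite {1}(divn_eq (e 0) (e 1)) addKn.
by env_rec.
Qed.

Lemma rec_fact : rec1 factorial.
Proof.
apply: env_rec_ext (_ : env_rec (fun e => iteri (e 0) (fun i r => i.+1 * r) 1)).
  by move=> e; elim: (e 0) => //= n ->.
by apply: env_rec_iteri; env_rec.
Qed.

#[local] Hint Resolve rec_mod rec_fact : env_rec.

(** * Coded sequences and recursion through coded tables *)

Definition nthc (c i : nat) := nth 0 (CodeSeq.decode c) i.

Lemma nthc_code s i : nthc (CodeSeq.code s) i = nth 0 s i.
Proof. by rewrite /nthc CodeSeq.codeK. Qed.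

Lemma leq_code_behead x s : CodeSeq.code s < (CodeSeq.code (x :: s)).
Proof.
rewrite /= -[X in X <= _]mul1n leq_mul ?expn_gt0 // ltnS.
by rewrite -addnn leq_addr.
Qed.

(** The tail of a nonempty sequence has a smaller code, so the head is recognized by a bounded
    search for the tail; [0] codes the empty sequence. *)
Lemma rec_code_head : rec1 (fun c => nthc c 0).
Proof.
apply: (@env_rec_graph (fun x e =>
  if e 0 == 0 then x == 0
  else has (fun t => e 0 == CodeSeq.code (x :: CodeSeq.decode t)) (iota 0 (e
    0)))).
- rewrite (_ : (fun e => _) = fun e => nat_of_bool (
    ((e 1 == 0) && (e 0 == 0)) || ((e 1 != 0) &&
    has (fun t => e 1 == 2 ^ (e 0) * (t + t).+1) (iota 0 (e 1))))).
    by env_rec.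
  apply: funext => e; case: (e 1 == 0); rewrite ?orbF //.
  congr nat_of_bool; apply: eq_has => t.
  by rewrite addnn /= CodeSeq.decodeK.
- move=> e; case: eqP => [->//|ne0]; rewrite /nthc.
  have := CodeSeq.decodeK (e 0).
  case: (CodeSeq.decode (e 0)) => [/esym/ne0 //|x s <-]; apply/hasP.
  exists (CodeSeq.code s); first by rewrite mem_iota leq_code_behead.
  by rewrite CodeSeq.codeK.
move=> e x; case: eqP => [->/eqP-> //|_ /hasP[t _ /eqP->]].
by rewrite nthc_code.
Qed.

Lemma rec_code_behead : rec1 (fun c => CodeSeq.code (behead (CodeSeq.decode
  c))).
Proof.
apply: (@env_rec_graph (fun t e =>
  if e 0 == 0 then t == 0
  else e 0 == CodeSeq.code (nthc (e 0) 0 :: CodeSeq.decode t))).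
- rewrite (_ : (fun e => _) = fun e => nat_of_bool (
    ((e 1 == 0) && (e 0 == 0)) || ((e 1 != 0) &&
    (e 1 == 2 ^ (nthc (e 1) 0) * (e 0 + e 0).+1)))).
    by env_rec; apply: (env_rec_app1 rec_code_head); env_rec.
  apply: funext => e; case: (e 1 == 0); rewrite ?orbF //.
  congr (nat_of_bool (_ == _)).
  by rewrite addnn /= CodeSeq.decodeK.
- move=> e; case: eqP => [->//|ne0]; rewrite CodeSeq.codeK /nthc.
  rewrite -{1}[e 0]CodeSeq.decodeK.
  by case: CodeSeq.decode (CodeSeq.decodeK (e 0)) => [/esym/ne0|].
move=> e x; case: eqP => [->/eqP-> //|_ /eqP->].
by rewrite CodeSeq.codeK /= CodeSeq.decodeK.
Qed.

Lemma rec_nthc : rec2 nthc.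
Proof.
apply: env_rec_ext (_ : env_rec (fun e =>
   nthc (iteri (e 1) (fun _ c => CodeSeq.code (behead (CodeSeq.decode c))) (e
     0)) 0)).
  move=> e; rewrite (_ : iteri _ _ _ = CodeSeq.code (drop (e 1) (CodeSeq.decode
    (e 0)))).
    by rewrite nthc_code nth_drop addn0.
  elim: (e 1) => [|i /= ->]; first by rewrite drop0 CodeSeq.decodeK.
  by rewrite CodeSeq.codeK -drop1 drop_drop add1n.
apply: (env_rec_app1 rec_code_head).
apply: env_rec_iteri; do ?exact: env_rec_var.
by apply: (env_rec_app1 rec_code_behead); env_rec.
Qed.

#[local] Hint Resolve rec_nthc : env_rec.

Lemma mem_iota0 n i : (i \in iota 0 n) = (i < n).
Proof. by rewrite mem_iota add0n. Qed.

Lemma env_rec_min (P : nat -> (nat -> nat) -> bool)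
    (exP : forall e, exists y, P y e) :
  env_rec (fun e => P (e 0) (fun i => e i.+1)) ->
  env_rec (fun e => ex_minn (exP e)).
Proof.
move=> rP; apply: (@env_rec_graph (fun y e =>
  P y e && all (fun z => ~~ P z e) (iota 0 y))).
- env_rec => //; apply: (env_rec_comp (g := fun i e =>
    if i is i'.+1 then e i'.+2 else e 0) rP).
  by case=> [|i]; env_rec.
- move=> e; case: ex_minnP => y -> min_y; apply/allP => z.
  by rewrite mem_iota0; apply: contraL => /min_y; rewrite -leqNgt.
move=> e y /andP[Py /allP min_y]; case: ex_minnP => z Pz /(_ y Py) le_zy.
apply/eqP; rewrite eqn_leq le_zy andbT leqNgt; apply/negP => lt_zy.
by have := min_y z; rewrite mem_iota0 lt_zy Pz => /(_ isT).
Qed.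

(* Course-of-values recursion on the first argument of [f], the recursive calls
   varying the second argument below [S]: the values below a given point form a
   coded table, found by minimization among the codes satisfying the step
   equation [G] everywhere. *)
Lemma env_rec_table (f : nat -> nat -> (nat -> nat) -> nat)
    (G : nat -> nat -> (nat -> nat -> nat) -> (nat -> nat) -> nat)
    (S N A : (nat -> nat) -> nat) :
  env_rec S -> env_rec N -> env_rec A -> (forall e, A e < S e) ->
  env_rec (fun e =>
    G (e 0) (e 1) (fun n s => nthc (nthc (e 2) n) s) (fun i => e i.+3)) ->
  (forall n s h e, s < S e ->
     (forall n' s', n' < n -> s' < S e -> h n' s' = f n' s' e) ->
     G n s h e = f n s e) ->
  env_rec (fun e => f (N e) (A e) e).
Proof.
move=> rS rN rA ltAS rG Gf.
pose look w n s := nthc (nthc w n) s.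
pose P w e := all (fun n => all (fun s => look w n s == G n s (look w) e)
  (iota 0 (S e))) (iota 0 (N e).+1).
(* The step equations determine the table: by strong induction on the row, [G] only looks at rows
   already known to be correct. *)
have Pf w e : P w e <-> forall n s, n <= N e -> s < S e -> look w n s = f n s e.
  split=> [Pw | wf].
    elim/ltn_ind => n IH s le_n lt_s.
    have /(allP Pw) Pn : n \in iota 0 (N e).+1 by rewrite mem_iota0.
    have /(allP Pn)/eqP -> : s \in iota 0 (S e) by rewrite mem_iota0.
    apply: Gf => // n' s' lt_n.
    by apply: IH => //; apply: leq_trans (ltnW lt_n) le_n.
  apply/allP => n; rewrite mem_iota0 ltnS => le_n; apply/allP => s.
  rewrite mem_iota0 => lt_s; rewrite wf // (Gf _ _ _ e) // => n' s' lt_n' lt_s'.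
  by rewrite wf // ltnW // (leq_trans lt_n').
pose w e := CodeSeq.code (mkseq (fun n =>
  CodeSeq.code (mkseq (fun s => f n s e) (S e))) (N e).+1).
have Pw e : P (w e) e.
  by apply/Pf => n s le_n lt_s; rewrite /look nthc_code nth_mkseq // nthc_code
    nth_mkseq.
have exP e : exists w, P w e by exists (w e).
apply: (env_rec_ext (f := fun e => look (ex_minn (exP e)) (N e) (A e))).
  by move=> e; case: ex_minnP => w' /Pf Pw' _; apply: Pw'.
have shift1 f' : env_rec f' -> env_rec (fun e => f' (fun i => e i.+1)).
  by move=> rf'; apply: env_rec_comp rf' _ => i; apply: env_rec_var.
have shift2 f' : env_rec f' -> env_rec (fun e => f' (fun i => e i.+2)).
  by move=> rf'; apply: env_rec_comp rf' _ => i; apply: env_rec_var.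
have rP : env_rec (fun e => P (e 0) (fun i => e i.+1)).
  rewrite /P /look; env_rec.
  - exact: shift1.
  - exact: shift2.
  (* Inside the two [all]s the entries are [s], [n], [w] in this order, while [rG] reads [n] before
     [s]. *)
  - apply: (env_rec_comp (g := fun i e =>
      match i with 0 => e 1 | 1 => e 0 | 2 => e 2 | i.+3 => e i.+3 end) rG).
    by move=> [|[|[|i]]]; env_rec.
rewrite /look; env_rec => //.
exact: env_rec_min rP.
Qed.

(** * Models of [T3] *)

Definition le_str (M : structure) (x y : M) := iMeet x y = x.

Definition atom (M : structure) (a : M) :=
  a <> iZero M /\ forall b, le_str b a -> b = iZero M \/ b = a.

(** [{classic M}] supplies the classical decidable equality that [uniq] needs. *)
Definition at_least (M : structure) n (x : M) :=
  exists s : seq {classic M},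
    [/\ uniq s, size s = n & forall a, a \in s -> atom a /\ le_str a x].

Lemma sat_bigand (M : structure) (v : nat -> M) n (P : pred 'I_n) F :
  sat v (\big[fAnd/fTop]_(j < n | P j) F j) <-> forall j, P j -> sat v (F j).
Proof.
(* [fAnd] is a mere constructor, not a monoid law, so the big conjunction is opened down to its
   fold. *)
rewrite bigop.unlock; have := mem_index_enum (T := 'I_n).
set r := index_enum _ => mem_r.
suff -> : sat v (reducebig fTop r (fun j => BigBody j fAnd (P j) (F j))) <->
    forall j, j \in r -> P j -> sat v (F j).
  by split=> h j; [apply: h; apply: mem_r | move=> _; apply: h].
elim: (r) => [|j s IHs] /=; first by split.
case: ifP => Pj /=; [split=> [[hj /IHs hs] k|h]|split=> [/IHs hs k|h]].
- by rewrite inE => /orP[/eqP->//|]; apply: hs.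
- by split; [apply: h; rewrite ?mem_head|apply/IHs => k ks; apply: h;
    rewrite inE ks orbT].
- by rewrite inE => /orP[/eqP->|]; [rewrite Pj|apply: hs].
- by apply/IHs => k ks; apply: h; rewrite inE ks orbT.
Qed.

Lemma sat_and (M : structure) (v : nat -> M) a b :
  sat v (fAnd a b) <-> sat v a /\ sat v b.
Proof. by []. Qed.

Lemma sat_bigor (M : structure) (v : nat -> M) n (P : pred 'I_n) F :
  sat v (\big[fOr/fBot]_(j < n | P j) F j) <-> exists2 j, P j & sat v (F j).
Proof.
rewrite bigop.unlock; have := mem_index_enum (T := 'I_n).
set r := index_enum _ => mem_r.
suff -> : sat v (reducebig fBot r (fun j => BigBody j fOr (P j) (F j))) <->
    exists j, [/\ j \in r, P j & sat v (F j)].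
  by split=> [[j []]|[j]]; exists j => //; split=> //; apply: mem_r.
elim: (r) => [|j s IHs] /=; first by split=> // -[j []].
case: ifP => Pj /=; split.
- case=> [hj|/IHs[k [ks Pk hk]]]; first by exists j; rewrite mem_head.
  by exists k; rewrite inE ks orbT.
- case=> k []; rewrite inE => /orP[/eqP->|ks]; first by left.
  by move=> Pk hk; right; apply/IHs; exists k.
- by case/IHs => k [ks Pk hk]; exists k; rewrite inE ks orbT.
- case=> k []; rewrite inE => /orP[/eqP->|ks]; first by rewrite Pj.
  by move=> Pk hk; apply/IHs; exists k.
Qed.

(** The nested updates act on distinct consecutive variables, so they amount to one simultaneous
    override. *)
Lemma sat_fExs (M : structure) a i n (v : nat -> M) :
  sat v (fExs i n a) <->
  exists w, sat (fun j => if i <= j < i + n then w j else v j) a.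
Proof.
have upd_cons m k w u d : (fun j => if k < j < k.+1 + m then w j else update u
  k d j) =
    (fun j => if k <= j < k + m.+1 then update w k d j else u j) :> (nat -> M).
  apply: funext => j; rewrite /update addSnnS.
  by case: (eqVneq j k) => [->|neq]; rewrite ?ltnn ?leqnn ?addnS ?ltnS
    ?leq_addr // ltn_neqAle eq_sym neq.
elim: n i v => [|n IHn] i v.
  have vE w : v = fun j => if i <= j < i + 0 then w j else v j.
    by apply: funext => j; rewrite addn0 leqNgt andNb.
  by split=> [|[w]]; [exists v|]; rewrite -vE.
split=> [[d /IHn[w]]|[w hw]]; first by rewrite upd_cons; exists (update w i d).
exists (w i); apply/IHn; exists w; rewrite upd_cons.
rewrite (_ : update w i (w i) = w) //.
by apply: funext => j; rewrite /update; case: eqP => // ->.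
Qed.

Lemma sat_fDistinct (M : structure) (v : nat -> M) i n :
  sat v (fDistinct i n) <-> forall j k, j < k < n -> v (i + j) <> v (i + k).
Proof.
rewrite sat_bigand; split=> [h j k /andP[ltjk ltkn]|h j _].
  have ltjn := ltn_trans ltjk ltkn.
  have := h (Ordinal ltjn) isT; rewrite sat_bigand => /(_ (Ordinal ltkn)).
  exact.
by apply/sat_bigand => k ltjk; apply: h; rewrite ltjk ltn_ord.
Qed.

Lemma sat_fAtom (M : structure) (v : nat -> M) i : sat v (fAtom i) <-> atom (v
  i).
Proof.
rewrite /= /atom /le_str /update eqxx; split=> -[a0 h]; split=> // b;
by have := h b; rewrite (ltn_eqF (ltnSn i)).
Qed.

(* The right-hand side is the defining formula of [fC n] in axiom [ax_C]. *)
Lemma sat_at_least (M : structure) (v : nat -> M) n :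
  sat v (fExs 1 n (fAnd
    (\big[fAnd/fTop]_(j < n) fAnd (fAtom (1 + j)) (fLe (1 + j) 0))
    (fDistinct 1 n))) <-> at_least n (v 0).
Proof.
pose u w j := if 1 <= j < 1 + n then w j else v j : M.
have uw w j : j < n -> u w (1 + j) = w (1 + j) by move=> ltj;
  rewrite /u ltn_add2l ltj.
rewrite sat_fExs; split=> [[w /sat_and[]]|[s [us ss hs]]].
  rewrite -/(u w) sat_bigand sat_fDistinct => hat dis.
  exists (mkseq (fun j => w (1 + j) : {classic M}) n); split; last 1 first.
  - move=> a /(nthP (iZero M : {classic M}))[j]; rewrite size_mkseq => ltj <-.
    rewrite nth_mkseq //; have /sat_and[/sat_fAtom] := hat (Ordinal ltj) isT.
    rewrite uw // => atj le_j; split=> //.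
    by have : le_str (u w (1 + j)) (v 0) by []; rewrite uw.
  - apply/(uniqP (iZero M : {classic M})) => j k; rewrite !inE size_mkseq.
    move=> ltj ltk; rewrite !nth_mkseq // => eqw.
    have neq j' k' : j' < k' < n -> w (1 + j') <> w (1 + k').
      by move=> /andP[ltjk ltkn]; have := dis j' k';
        rewrite ltjk ltkn => /(_ isT); rewrite !uw // (ltn_trans ltjk).
    by case: (ltngtP j k) => // lt; [case: (neq j k)|case: (neq k j)];
      rewrite ?lt.
  - by rewrite size_mkseq.
pose w j : M := nth (iZero M : {classic M}) s j.-1.
exists w; rewrite -/(u w); apply/sat_and; split.
  apply/sat_bigand => j _; apply/sat_and.
  have [atj le_j] : atom (w (1 + j)) /\ le_str (w (1 + j)) (v 0).
    by apply: hs; apply: mem_nth; rewrite ss; apply: ltn_ord.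
  split; first by apply/sat_fAtom; rewrite uw.
  by change (le_str (u w (1 + j)) (v 0)); rewrite uw.
apply/sat_fDistinct => j k /andP[ltjk ltkn]; rewrite !uw ?(ltn_trans ltjk) //.
move=> eqw; have := nth_uniq (iZero M : {classic M}) (_ : j < size s) (_ : k <
  size s) us.
rewrite ss => /(_ (ltn_trans ltjk ltkn) ltkn); rewrite ltn_eqF // => /eqP;
  apply.
exact: eqw.
Qed.

(** * Elements as sets of atoms, and counting atoms *)

Section Models.
Variables (M : structure) (M_T3 : models M T3).
Implicit Types (x y z a b c : M).
Local Notation "x ⊓ y" := (iMeet x y) (at level 40, left associativity).
Local Notation "x ⊔ y" := (iJoin x y) (at level 50, left associativity).
Local Notation "x ≼ y" := (le_str x y) (at level 70).
Local Notation "⊥" := (iZero M).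
Local Notation "⊤" := (iOne M).
Local Notation "∁ x" := (iCompl x) (at level 35).

Let v0 : nat -> M := fun=> ⊥.
Let ax phi (Tphi : T3 phi) := M_T3 Tphi v0.

Let meetC x y : x ⊓ y = y ⊓ x. Proof. exact: (ax ax_meetC x y). Qed.
Let joinC x y : x ⊔ y = y ⊔ x. Proof. exact: (ax ax_joinC x y). Qed.
Let meetA x y z : x ⊓ (y ⊓ z) = x ⊓ y ⊓ z.
Proof. exact: (ax ax_meetA x y z). Qed.
Let meetK x y : x ⊓ (x ⊔ y) = x. Proof. exact: (ax ax_meetK x y). Qed.
Let joinK x y : x ⊔ (x ⊓ y) = x. Proof. exact: (ax ax_joinK x y). Qed.
Let meetD x y z : x ⊓ (y ⊔ z) = x ⊓ y ⊔ x ⊓ z.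
Proof. exact: (ax ax_meetD x y z). Qed.
Let meetN x : x ⊓ ∁ x = ⊥. Proof. exact: (ax ax_meetN x). Qed.
Let joinN x : x ⊔ ∁ x = ⊤. Proof. exact: (ax ax_joinN x). Qed.
Let meetxx x : x ⊓ x = x. Proof. by rewrite -{2}(joinK x x) meetK. Qed.
Let meetx1 x : x ⊓ ⊤ = x. Proof. by rewrite -(joinN x) meetK. Qed.
Let meetx0 x : x ⊓ ⊥ = ⊥.
Proof. by rewrite -(meetN x) meetA meetxx. Qed.
Let joinx0 x : x ⊔ ⊥ = x. Proof. by rewrite -{2}(joinK x ⊥) meetx0. Qed.

Lemma atomic_model x : x <> ⊥ -> exists2 a, atom a & a ≼ x.
Proof.
move=> x0; have [a [/sat_fAtom ata le_ax]] := ax ax_atomic x x0.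
by exists a.
Qed.

Lemma le_trans_model a x y : a ≼ x -> x ≼ y -> a ≼ y.
Proof. by rewrite /le_str => ax' xy; rewrite -ax' -meetA xy. Qed.

Lemma le_meet a x y : a ≼ x ⊓ y <-> a ≼ x /\ a ≼ y.
Proof.
split=> [h|[ax' ay]]; last by rewrite /le_str meetA ax' ay.
split; apply: le_trans_model h _; rewrite /le_str.
  by rewrite meetC meetA meetxx.
by rewrite -meetA meetxx.
Qed.

Lemma atom_le0 a : atom a -> ~ a ≼ ⊥.
Proof. by move=> [a0 _]; rewrite /le_str meetx0 => /esym. Qed.

Lemma le_one a : a ≼ ⊤. Proof. exact: meetx1. Qed.

(** The meet of an atom with [x] is either the atom or [⊥]; in the second case distributivity puts
    the atom below [y]. *)
Lemma atom_le_join a x y : atom a -> a ≼ x ⊔ y <-> a ≼ x \/ a ≼ y.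
Proof.
move=> [a0 min_a]; split=> [|[]]; last first.
- by move=> ay; apply: le_trans_model ay _; rewrite /le_str joinC meetK.
- by move=> ax'; apply: le_trans_model ax' _; rewrite /le_str meetK.
have le_a z : a ⊓ z ≼ a by rewrite /le_str meetC meetA meetxx.
rewrite /le_str meetD.
by case: (min_a _ (le_a x)) => ->; [rewrite joinC joinx0; right|left].
Qed.

Lemma atom_le_compl a x : atom a -> a ≼ ∁ x <-> ~ a ≼ x.
Proof.
move=> ata; split=> [anx ax'|nax].
  by apply: (atom_le0 ata); rewrite -(meetN x); apply/le_meet.
by have /(atom_le_join _ _ ata)[] : a ≼ x ⊔ ∁ x by rewrite joinN; apply: le_one.
Qed.

Lemma atom_le_atom a b : atom a -> atom b -> a ≼ b <-> a = b.
Proof.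
move=> [a0 _] [b0 min_b]; split=> [/min_b[]//|->]; exact: meetxx.
Qed.

(** If [u] is not below [w], atomicity gives an atom below [u ⊓ ∁ w]. From here on, Boolean
    identities are proved by propositional reasoning about one atom. *)
Lemma atom_ext x y : (forall a, atom a -> a ≼ x <-> a ≼ y) -> x = y.
Proof.
have sub u w : (forall a, atom a -> a ≼ u -> a ≼ w) -> u ≼ w.
  move=> h; case: (EM (u ⊓ ∁ w = ⊥)) => [uw0|/atomic_model[a ata]].
    by rewrite /le_str -[RHS]meetx1 -(joinN w) meetD uw0 joinx0.
  by move=> /le_meet[/(h _ ata) aw /(atom_le_compl _ ata)].
move=> h; have xy : x ≼ y by apply: sub => a /h ->.
have yx : y ≼ x by apply: sub => a /h ->.
by rewrite -xy meetC yx.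
Qed.

(** Phrased by atoms, in the form that counting uses; [disjoint_meet] gives the equation that the
    [Res] axioms ask for. *)
Definition disjoint x y := forall a, atom a -> a ≼ x -> ~ a ≼ y.

Lemma disjoint_meet x y : disjoint x y -> x ⊓ y = ⊥.
Proof.
move=> dxy; apply: atom_ext => a ata; split=> [/le_meet[/(dxy _ ata)]//|].
by move/(atom_le0 ata).
Qed.

Local Notation AL := at_least.

Lemma iC_at_least (n : posnat) x : iC n x <-> AL n x.
Proof.
rewrite -[x in AL n x]/(update v0 0 x 0).
by rewrite -sat_at_least; apply: (ax (ax_C n) x).
Qed.

Lemma at_least0 x : AL 0 x. Proof. by exists [::]. Qed.

Lemma at_leastS n m x : m <= n -> AL n x -> AL m x.
Proof.
move=> le_mn [s [us ss hs]]; exists (take m s); split.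
- exact: take_uniq.
- by rewrite size_takel // ss.
- by move=> a /mem_take; apply: hs.
Qed.

Lemma at_least_sub n x y : (forall a, atom a -> a ≼ x -> a ≼ y) -> AL n x -> AL
  n y.
Proof.
move=> sub [s [us ss hs]]; exists s; split=> // a /hs[ata ax']; split=> //.
exact: sub.
Qed.

Lemma at_least1 x : AL 1 x <-> x <> ⊥.
Proof.
split=> [[[|a s] [_ // _ hs]]|/atomic_model[a ata le_ax]].
  have [ata le_ax] := hs a (mem_head _ _).
  by move=> x0; apply: (atom_le0 ata); rewrite -x0.
by exists [:: a]; split=> // b; rewrite inE => /eqP->.
Qed.

Lemma at_least_join j x y : disjoint x y ->
  AL j (x ⊔ y) <-> exists j1 j2, [/\ j1 + j2 = j, AL j1 x & AL j2 y].
Proof.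
move=> dxy; split=> [[s [us ss hs]]|[j1 [j2 [<-]]]].
  pose p a := `[< a ≼ x >].
  exists (count p s), (count (predC p) s); split; first by rewrite count_predC.
    exists (filter p s); split; rewrite ?filter_uniq ?size_filter // => a.
    by rewrite mem_filter => /andP[/asboolP ax' /hs[]].
  exists (filter (predC p) s); split; rewrite ?filter_uniq ?size_filter // => a.
  rewrite mem_filter /= => /andP[/asboolP nax /hs[ata /(atom_le_join _ _
    ata)[]//]].
move=> [s1 [u1 <- h1]] [s2 [u2 <- h2]]; exists (s1 ++ s2); split.
- rewrite cat_uniq u1 u2 andbT; apply/hasPn => a /h2[ata ay].
  by apply/negP => /h1[_ ax']; apply: dxy ay.
- exact: size_cat.
- by move=> a; rewrite mem_cat => /orP[/h1|/h2] [ata le_a]; split=> //;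
    apply/(atom_le_join _ _ ata); [left|right].
Qed.

Definition has_card k x := forall j, AL j x <-> j <= k.

(** The join of [k] chosen atoms has no other atoms below it. This carves pieces of standard finite
    size out of any large enough element. *)
Lemma has_card_exists k x : AL k x ->
  exists y, [/\ has_card k y & forall a, atom a -> a ≼ y -> a ≼ x].
Proof.
move=> [s [us <- hs]]; exists (foldr (@iJoin M) ⊥ s).
have mem_y a : atom a -> a ≼ foldr (@iJoin M) ⊥ s <-> (a : {classic M}) \in s.
  move=> ata; elim: s {us} hs => [|b s IHs] hs;
    first by split=> // /(atom_le0 ata).
  have atb : atom b by apply: (hs b _).1; rewrite mem_head.
  rewrite inE /= atom_le_join // atom_le_atom // IHs.
    by split=> [[->|->]|/orP[/eqP->|]]; rewrite ?eqxx ?orbT; auto.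
  by move=> c cs; apply: hs; rewrite inE cs orbT.
split=> [j|a ata /(mem_y a ata)/hs[]//]; split=> [[t [ut <- ht]]|lej].
  by apply: uniq_leq_size => // a /ht[ata /(mem_y a ata)].
apply: at_leastS lej _; exists s; split=> // a as'.
by have [ata _] := hs a as'; split=> //; apply/mem_y.
Qed.

Lemma has_card_lt n x : ~ AL n x -> exists2 k, k < n & has_card k x.
Proof.
elim: n => [[]|n IHn nAL]; first exact: at_least0.
case: (EM (AL n x)) => [ALn|/IHn[k ltk ck]]; last by exists k => //;
  apply: ltnW.
exists n => // j; split=> [ALj|/at_leastS]; last by apply.
by rewrite leqNgt; apply/negP => ltnj; apply: nAL; apply: at_leastS ALj.
Qed.

Lemma has_card_joinl k x y j : disjoint x y -> has_card k x ->
  AL (j + k) (x ⊔ y) <-> AL j y.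
Proof.
move=> dxy ck; rewrite at_least_join //; split=> [[j1 [j2 [eqj /ck lej1]]]|ALj].
  by apply: at_leastS; lia.
by exists k, j; rewrite addnC; split=> //; apply/ck.
Qed.

End Models.

(* Extended cardinals are coded by natural numbers: [0] stands for infinity and
   [k.+1] for the finite cardinal [k]. *)
Definition oadd (a b : nat) := if (a == 0) || (b == 0) then 0 else (a + b).-1.

Lemma oaddC : commutative oadd.
Proof. by move=> a b; rewrite /oadd orbC addnC. Qed.

Lemma oaddA : associative oadd.
Proof.
by move=> [|a] [|b] [|c]; rewrite /oadd /= ?orbT ?addSn ?addnS //= ?orbT //
  addnA.
Qed.

Lemma oadd1n : left_id 1 oadd. Proof. by case. Qed.

(** * Elements described by extended cardinals: splitting and merging *)

Section Similarity.
Variables (M : structure) (M_T3 : models M T3) (D : posnat).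
Implicit Types (x y z a b c : M).
Local Notation "x ⊓ y" := (iMeet x y) (at level 40, left associativity).
Local Notation "x ⊔ y" := (iJoin x y) (at level 50, left associativity).
Local Notation "x ≼ y" := (le_str x y) (at level 70).
Local Notation "⊥" := (iZero M).
Local Notation "∁ x" := (iCompl x) (at level 35).
Local Notation AL := at_least.

Let v0 : nat -> M := fun=> ⊥.
Let ax phi (Tphi : T3 phi) := M_T3 Tphi v0.

Lemma le_atoms x y : (forall a, atom a -> a ≼ x -> a ≼ y) -> x ≼ y.
Proof.
move=> sub; apply: (atom_ext M_T3) => a ata; rewrite le_meet //.
by split=> [[]|ax'] //; split=> //; apply: sub.
Qed.

Lemma atoms_le x y a : x ≼ y -> a ≼ x -> a ≼ y.
Proof. by move=> xy ax'; apply: le_trans_model xy. Qed.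

Lemma fin_le x y : x ≼ y -> iFin y -> iFin x.
Proof. by move=> le_xy Fy; apply: (ax ax_Fin_down y x). Qed.

Lemma fin_join x y : iFin x -> iFin y -> iFin (x ⊔ y).
Proof. by move=> Fx Fy; apply: (ax ax_Fin_join x y). Qed.

Lemma le_joinl x y : x ≼ x ⊔ y.
Proof. by apply: le_atoms => a ata; rewrite atom_le_join //; left. Qed.

Lemma le_joinr x y : y ≼ x ⊔ y.
Proof. by apply: le_atoms => a ata; rewrite atom_le_join //; right. Qed.

(** Contrapositive of the axiom putting elements with few atoms in [Fin]. Passing to [n.+1] matches
    that axiom, which negates [C] at the positive index [n.+1]. *)
Lemma at_least_notfin n x : ~ iFin x -> AL n x.
Proof.
move=> nFx; apply: (@at_leastS _ n.+1) => //.
apply/(iC_at_least M_T3 (succ_pos n)); apply: contra_notP nFx => nC.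
exact: (ax (ax_Fin_card n) x nC).
Qed.

Lemma has_card_fin k x : has_card k x -> iFin x.
Proof.
by move=> ck; apply: contrapT => /(at_least_notfin k.+1)/ck; rewrite ltnn.
Qed.

Definition res (r : nat) x := iRes D r x.

Lemma res_fin r x : res r x -> iFin x.
Proof. exact: (ax (ax_Res_Fin D r) x). Qed.

Lemma modzE (r s : nat) : (r = s %[mod D])%Z <-> r = s %[mod D].
Proof. by rewrite !modz_nat; split=> [[]|->]. Qed.

Lemma res_eq r s x : r = s %[mod D] -> res r x -> res s x.
Proof. by move/modzE => eqrs; apply: (ax (ax_Res_cong eqrs) x). Qed.

Lemma res_uniq r s x : res r x -> res s x -> r = s %[mod D].
Proof.
move=> rx sx; apply: contrapT => neq.
have {}neq : ((r : int) <> s %[mod D])%Z by move/modzE.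
exact: (ax (ax_Res_disj neq) x rx sx).
Qed.

Lemma res_total x : iFin x -> exists r, res r x.
Proof.
by move=> Fx; have /sat_bigor[r _ rx] := ax (ax_Res_total D) x Fx; exists r.
Qed.

Lemma res_join r s x y : disjoint x y -> res r x -> res s y -> res (r + s) (x ⊔
  y).
Proof.
move=> /(disjoint_meet M_T3) dxy rx sy.
exact: (ax (ax_Res_join D r s) x y (conj dxy (conj rx sy))).
Qed.

(** Residues can be cancelled: [y] has some residue [t], and comparing [r + t] with [r + s] on the
    join pins [t] modulo [D]. *)
Lemma res_sub r s x y : disjoint x y -> res r x -> res (r + s) (x ⊔ y) -> res s
  y.
Proof.
move=> dxy rx rsxy; have Fy := fin_le (le_joinr x y) (res_fin rsxy).
have [t ty] := res_total Fy; apply: (res_eq _ ty); apply/eqP.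
by rewrite -(eqn_modDl r); apply/eqP; apply: (res_uniq _ rsxy); apply: res_join.
Qed.

Lemma res_card k x : has_card k x -> res k x.
Proof.
move=> ck; have Fx := has_card_fin ck; case: (posnP k) => [k0|k_gt0];
  last first.
  pose k' : posnat := exist _ k k_gt0.
  apply: (ax (@ax_Res_card D k' k _) x) => //; split=> //; split.
    by apply/(iC_at_least M_T3 k'); apply/ck.
  by move/(iC_at_least M_T3 (succ_pos k'))/ck; rewrite ltnn.
(* The axioms give no residue of [⊥] directly, but [⊥ ⊔ ⊥ = ⊥] forces it. *)
have x0 : x = ⊥ by apply: contrapT => /(at_least1 M_T3)/ck; rewrite k0.
have [t tx] := res_total Fx; rewrite k0; apply: (res_eq _ tx); apply/eqP.
have d00 : disjoint x x by move=> a ata; rewrite x0 => /(atom_le0 M_T3 ata).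
have xx : x ⊔ x = x by apply: (atom_ext M_T3) => a ata;
  rewrite atom_le_join //; tauto.
have := res_join d00 tx tx; rewrite xx => /res_uniq-/(_ _ tx)/eqP.
by rewrite -{3}[t]addn0 eqn_modDl.
Qed.

(** [k] is a stand-in rather than a cardinality: if [x] has infinitely many atoms, every [k >= N] in
    its residue class qualifies. *)
Definition sim N k x := [/\ iFin x, res k x & forall j, j <= N -> (AL j x <-> j
  <= k)].

Definition osim N (kappa : nat) x :=
  if kappa is k.+1 then sim N k x else ~ iFin x.

Lemma sim_card N k x : has_card k x -> sim N k x.
Proof.
by move=> ck; split=> [||j _]; [apply: has_card_fin ck|apply: res_card|apply:
  ck].
Qed.

Lemma sim_join N k l x y : disjoint x y -> sim N k x -> sim N l y ->
  sim N (k + l) (x ⊔ y).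
Proof.
move=> dxy [Fx rx cx] [Fy ry cy]; split; [exact: fin_join|exact: res_join|].
move=> j lejN; rewrite (at_least_join M_T3) //; split.
  by case=> j1 [j2 [eqj /cx h1 /cy h2]]; rewrite -eqj; apply: leq_add;
    [apply: h1|apply: h2]; lia.
move=> lej; exists (minn j k), (j - k); split; first by lia.
  by apply/cx; lia.
by apply/cy; lia.
Qed.

Lemma osim_join N k l x y : disjoint x y -> osim N k x -> osim N l y ->
  osim N (oadd k l) (x ⊔ y).
Proof.
case: k l => [|k] [|l] dxy /=; rewrite /oadd /=; last first.
  by rewrite addnS /=; apply: sim_join.
all: move=> sx sy /fin_le Fxy.
all: by [case: sx; apply: Fxy; apply: le_joinl|case: sy; apply: Fxy;
  apply: le_joinr].
Qed.

Lemma osim_bot N : osim N 1 ⊥.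
Proof.
apply: sim_card => -[|j]; first by split=> // _; apply: at_least0.
by split=> // /(at_leastS (ltn0Sn j))/(at_least1 M_T3).
Qed.

(** Below [N + D] atoms the count is exact; from there on any number in the interval
    [N, ..., N + D - 1] with the right residue will do, and [D] consecutive numbers contain one. *)
Lemma sim_exists N x : iFin x -> exists2 k, k < N + D & sim N k x.
Proof.
move=> Fx; have D_gt0 : 0 < D := valP D.
case: (EM (AL (N + D) x)) => [ALx|/(has_card_lt) [k ltk ck]]; last first.
  by exists k => //; apply: sim_card.
have [r rx] := res_total Fx.
(* Adding [D * N] keeps the subtraction of [N] within the naturals and does not affect the
   residue. *)
exists (N + (r + D * N - N) %% D); first by rewrite ltn_add2l ltn_mod.
split=> // [|j lejN].
  apply: res_eq rx; rewrite modnDmr subnKC; last by have := leq_pmull N D_gt0;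
    lia.
  by rewrite mulnC addnC modnMDl.
split=> _; first exact: leq_trans lejN (leq_addr _ _).
by apply: at_leastS ALx; lia.
Qed.

Lemma join_diff x y : y ≼ x -> disjoint y (x ⊓ ∁ y) /\ y ⊔ (x ⊓ ∁ y) = x.
Proof.
move=> le_yx; split=> [a ata ay|]; first by rewrite le_meet // atom_le_compl
  //; tauto.
apply: (atom_ext M_T3) => a ata; rewrite atom_le_join // le_meet //
  atom_le_compl //.
split=> [[|[]]|] //; first exact: atoms_le.
by case: (EM (a ≼ y)); tauto.
Qed.

Lemma disjointC x y : disjoint x y -> disjoint y x.
Proof. by move=> dxy a ata ay ax'; apply: dxy ay. Qed.

Lemma joinC_model x y : x ⊔ y = y ⊔ x.
Proof. exact: (ax ax_joinC x y). Qed.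

(* A part of size [k <= l] is realized by [N <= k' < N + D] atoms with
   [k' = k %[mod D]] when [k] is large, which leaves enough for the other. *)
Lemma osim_split N N' k l x : 2 * (N + D) <= N' -> osim N' (oadd k l) x ->
  exists y z, [/\ disjoint y z, y ⊔ z = x, osim N k y & osim N l z].
Proof.
move=> leN'; have D_gt0 : 0 < D := valP D.
(* Here the first part is finite and the smaller one: [l'] is a code, so [k' < l'] compares the
   cardinals [k'] and [l' - 1] weakly. *)
have small k' l' : l' = 0 \/ k' < l' -> osim N' (oadd k'.+1 l') x ->
    exists y z, [/\ disjoint y z, y ⊔ z = x, osim N k'.+1 y & osim N l' z].
  move=> le_kl sx.
  pose r := if k' < N + D then k' else N + (k' - N) %% D.
  have ltr : r < N + D by rewrite /r; case: ifP => // _;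
    rewrite ltn_add2l ltn_mod.
  have ler : r <= k'.
    by rewrite /r; case: ltnP => // h; have := leq_mod (k' - N) D; lia.
  have rk : r = k' %[mod D].
    by rewrite /r; case: ltnP => // h; rewrite modnDmr subnKC //; lia.
  have rj j : j <= N -> (j <= r) = (j <= k') by rewrite /r; case: ltnP => //;
    lia.
  have ALr : AL r x.
    case: l' le_kl sx => [_|l' _]; first exact: at_least_notfin.
    by rewrite /oadd /= addnS => -[_ _] ->; lia.
  have [y [cy sub]] := has_card_exists M_T3 ALr.
  have [dyz yzx] := join_diff (le_atoms sub).
  exists y, (x ⊓ ∁ y); split=> //.
    split; [exact: has_card_fin cy|exact: res_eq (res_card cy)|].
    by move=> j lej; rewrite cy rj.
  case: l' le_kl sx => [_|l' le_kl] /=.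
    rewrite /oadd /= => nFx Fz; apply: nFx; rewrite -yzx.
    by apply: fin_join Fz; apply: has_card_fin cy.
  rewrite /oadd /= addnS /= => -[Fx rx cx]; split.
  - by apply: fin_le Fx; rewrite -[X in _ ≼ X]yzx; apply: le_joinr.
  - apply: (res_sub dyz (res_card cy)); rewrite yzx; apply: res_eq rx.
    by apply/eqP; rewrite eqn_modDr eq_sym; apply/eqP.
  move=> j lej; rewrite -(has_card_joinl M_T3 _ dyz cy) yzx cx; last by lia.
  (* If [r] differs from [k'], then [k' >= N + D]; the second cardinal is no smaller, so both sides
     hold for [j <= N]. *)
  case: le_kl => // le_kl; rewrite /r; case: ltnP => h; first by lia.
  by split; have := ltn_pmod (k' - N) D_gt0; lia.
case: (leqP k l) => [le_kl|lt_lk].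
  case: k le_kl => [|k] le_kl; last by apply: small; right.
  case: l le_kl => [|l] _.
    rewrite /oadd /= => nFx.
    have [y [[le_yx _] [nFy nFz]]] := ax ax_main x nFx.
    have [dyz yzx] := join_diff le_yx.
    by exists y, (x ⊓ ∁ y).
  rewrite oaddC => /small; case; first by left.
  move=> y [z [dyz yzx sy sz]]; exists z, y; split=> //; first exact: disjointC.
  by rewrite joinC_model.
rewrite oaddC; case: k lt_lk => // k lt_lk sx.
case: l lt_lk sx => [|l] lt_lk sx.
  by rewrite oaddC in sx; apply: small sx; left.
have [|y [z [dyz yzx sy sz]]] := small _ _ _ sx; first by right; lia.
by exists z, y; split=> //; [exact: disjointC|rewrite joinC_model].
Qed.

(** A part with fewer than [N + D] atoms is counted exactly and the other part receives the
    difference. If both are larger, [x] receives a representative below [N + D] and [y] the rest. If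
    the join is not in [Fin], some part is not, and the sum is infinite whatever the other is. The
    bounds on [l] and [m] are what keeps the quantifier search finite. *)
Lemma osim_merge N N' k x y : 2 * (N + D) <= N' -> disjoint x y ->
  osim N' k (x ⊔ y) ->
  exists l m, [/\ oadd l m = k, osim N l x, osim N m y &
    l <= maxn k (N + D) /\ m <= maxn k (N + D)].
Proof.
move=> leN' dxy.
have exact_part k' l y' z' : disjoint y' z' -> has_card l y' -> l < N + D ->
    sim N' k' (y' ⊔ z') -> l <= k' /\ sim N (k' - l) z'.
  move=> dyz cy ltl [Fx rx cx].
  have le_l : l <= k' by apply/cx; [lia|apply: (at_least_sub (x := y')) => //
    [a _|];
    [apply: atoms_le; apply: le_joinl|apply/cy]].
  split=> //; split; first by apply: fin_le Fx; apply: le_joinr.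
    by apply: (res_sub dyz (res_card cy)); rewrite subnKC.
  by move=> j lej; rewrite -(has_card_joinl M_T3 _ dyz cy) cx; lia.
case: k => [|k] /=; last first.
  move=> sx; have [Fx rx cx] := sx.
  case: (EM (AL (N + D) x)) => [ALx|/has_card_lt[l ltl cl]]; last first.
    have [lel sy] := exact_part _ _ _ _ dxy cl ltl sx.
    exists l.+1, (k - l).+1; split; [rewrite /oadd /=;
      lia|exact: sim_card|exact: sy|lia].
  case: (EM (AL (N + D) y)) => [ALy|/has_card_lt[l ltl cl]]; last first.
    rewrite joinC_model in sx.
    have [lel sy] := exact_part _ _ _ _ (disjointC dxy) cl ltl sx.
    exists (k - l).+1, l.+1; split; [rewrite /oadd /=;
      lia|exact: sy|exact: sim_card|lia].
  have Fx' := fin_le (le_joinl x y) Fx; have Fy := fin_le (le_joinr x y) Fx.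
  (* Both parts have [N + D] atoms, and the precision [N'] is enough to see their sum in [k]; hence
     [k - l] exceeds [N] for each [l < N + D]. *)
  have lek : 2 * (N + D) <= k.
    apply/cx => //; apply/at_least_join => //.
    by exists (N + D), (N + D); split=> //; lia.
  have [l ltl [_ rl cl]] := sim_exists N Fx'.
  have leNl : N <= l by apply/cl => //; apply: at_leastS ALx; lia.
  exists l.+1, (k - l).+1; split; [rewrite /oadd /=; lia|by []| |lia].
  split=> //.
    by apply: (res_sub dxy rl); rewrite subnKC //; lia.
  by move=> j lej; split=> _; [lia|apply: at_leastS ALy; lia].
move=> nFxy; case: (EM (iFin x)) => Fx; case: (EM (iFin y)) => Fy.
- by case: nFxy; apply: fin_join.
- have [l ltl sl] := sim_exists N Fx; exists l.+1, 0; split=> //; lia.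
- have [l ltl sl] := sim_exists N Fy; exists 0, l.+1; split=> //; lia.
- by exists 0, 0.
Qed.

End Similarity.

(** * Evaluation of formulas *)

HB.instance Definition _ := Monoid.isComLaw.Build nat 1 oadd oaddA oaddC oadd1n.

(** Cells are indexed by numbers: digit [i] of the index tells whether the cell lies below variable
    [i] or below its complement. *)
Fixpoint bit (i p : nat) : bool := if i is j.+1 then bit j p./2 else odd p.

Lemma bitE i p : bit i p = (p %/ 2 ^ i) %% 2 :> nat.
Proof.
elim: i p => [|i IHi] p /=; first by rewrite divn1 modn2.
by rewrite IHi -divn2 -divnMA expnS.
Qed.

(** With digit [i] of [p] clear, [p] and [p + 2 ^ i] index the two cells that merge when variable
    [i] is forgotten. *)
Lemma bit_add i j p : ~~ bit i p -> bit j (p + 2 ^ i) = (j == i) || bit j p.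
Proof.
elim: i j p => [|i IHi] [|j] p /= nb.
- by rewrite addn1 /= nb.
- by rewrite addn1 -uphalfE uphalf_half (negbTE nb).
- by rewrite expnS mul2n oddD odd_double addbF.
- by rewrite expnS mul2n halfD odd_double doubleK andbF add0n eqSS; apply: IHi.
Qed.

Lemma bit_inj m p q : p < 2 ^ m -> q < 2 ^ m ->
  (forall i, i < m -> bit i p = bit i q) -> p = q.
Proof.
elim: m p q => [|m IHm] p q; first by rewrite !ltnS !leqn0 => /eqP-> /eqP->.
rewrite expnS mul2n => ltp ltq eqb.
rewrite -[p]odd_double_half -[q]odd_double_half -[odd p]/(bit 0 p) eqb //;
  congr (_ + _.*2).
by apply: IHm => [||i lti]; [lia|lia|apply: (eqb i.+1)].
Qed.

Fixpoint num_of_bits m (f : nat -> bool) : nat :=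
  if m is m'.+1 then f 0 + (num_of_bits m' (fun i => f i.+1)).*2 else 0.

Lemma num_of_bits_lt m f : num_of_bits m f < 2 ^ m.
Proof.
elim: m f => //= m IHm f; rewrite expnS.
by have := IHm (fun i => f i.+1); case: (f 0); lia.
Qed.

Lemma bit_num_of_bits m f i : i < m -> bit i (num_of_bits m f) = f i.
Proof.
elim: m f i => //= m IHm f [|i] lti /=; first by rewrite oddD odd_double addbF
  oddb.
by rewrite half_bit_double IHm.
Qed.

Lemma bit_add_lt m i p : i < m -> p < 2 ^ m -> ~~ bit i p -> p + 2 ^ i < 2 ^ m.
Proof.
elim: m i p => // m IHm [|i] p lti; rewrite !expnS /= => ltp nb.
  by have := odd_double_half p; rewrite (negbTE nb); lia.
have := IHm i p./2 lti _ nb; have := odd_double_half p.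
by case: (odd p); lia.
Qed.

Lemma bit_clear m i q : i < m -> q < 2 ^ m -> bit i q ->
  exists p, [/\ p < 2 ^ m, ~~ bit i p & q = p + 2 ^ i].
Proof.
move=> ltim ltq bq; pose p := num_of_bits m (fun j => (j != i) && bit j q).
have nb : ~~ bit i p by rewrite bit_num_of_bits // eqxx.
have ltp : p < 2 ^ m by apply: num_of_bits_lt.
exists p; split=> //; apply: (@bit_inj m) => //; first exact: bit_add_lt.
move=> j ltj; rewrite bit_add // bit_num_of_bits //.
by case: eqP => //= ->.
Qed.

(** Evaluation in the two-element algebra at the digits of [p]: it tells whether cell [p] is part of
    [t] or disjoint from it. *)
Fixpoint tval (p : nat) (t : term) : bool :=
  match t with
  | tVar i => bit i p
  | tZero => false
  | tOne => true
  | tMeet t u => tval p t && tval p u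
  | tJoin t u => tval p t || tval p u
  | tCompl t => ~~ tval p t
  end.

Definition osize m (s : nat -> nat) (t : term) : nat :=
  \big[oadd/1]_(p < 2 ^ m) if tval p t then s p else 1.

(** Changing variable [i] preserves the join of two cells whose indices differ only in digit [i],
    hence their sum. An infinite sum has infinitely many splittings; the cap [Q] leaves finitely
    many, and by [osim_merge] enough of them. *)
Definition upd m Q i s s' : bool :=
  all (fun p => ~~ bit i p ==>
      [&& oadd (nthc s' p) (nthc s' (p + 2 ^ i)) ==
            oadd (nthc s p) (nthc s (p + 2 ^ i)),
          nthc s' p <= maxn (oadd (nthc s p) (nthc s (p + 2 ^ i))) Q
        & nthc s' (p + 2 ^ i) <= maxn (oadd (nthc s p) (nthc s (p + 2 ^ i))) Q])
    (iota 0 (2 ^ m)).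

(** Congruence to an integer in natural arithmetic, where recursiveness can be shown: [Negz j] is
    [- j.+1], so [j.+1] is moved to the other side. *)
Definition int_congr (n : nat) (r : int) (k : nat) : bool :=
  match r with
  | Posz j => k %% n == j %% n
  | Negz j => (k + j.+1) %% n == 0
  end.

(* [s] codes the sequence of the extended cardinals of the [2 ^ m] cells cut out
   by the first [m] variables; a quantifier ranges over the refinements [s'] of
   the cells below [S] allowed by [upd]. *)
Fixpoint ev m Q S (a : formula) (s : nat) : bool :=
  match a with
  | fBot => false
  | fEq t u => all (fun p => (tval p t != tval p u) ==> (nthc s p == 1)) (iota
    0 (2 ^ m))
  | fC n t => (osize m (nthc s) t == 0) || (n < osize m (nthc s) t)
  | fFin t => osize m (nthc s) t != 0
  | fRes n r t =>
      (osize m (nthc s) t != 0) && int_congr n r (osize m (nthc s) t).-1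
  | fImp a b => ev m Q S a s ==> ev m Q S b s
  | fAnd a b => ev m Q S a s && ev m Q S b s
  | fOr a b => ev m Q S a s || ev m Q S b s
  | fAll i a => all (fun s' => upd m Q i s s' ==> ev m Q S a s') (iota 0 S)
  | fEx i a => has (fun s' => upd m Q i s s' && ev m Q S a s') (iota 0 S)
  end.

Fixpoint tbounded (m : nat) (t : term) : bool :=
  match t with
  | tVar i => i < m
  | tZero | tOne => true
  | tMeet t u | tJoin t u => tbounded m t && tbounded m u
  | tCompl t => tbounded m t
  end.

(** Besides the variables, [m] bounds the indices of [fC] and [fRes], so that a precision above [m]
    and the modulus [m!] decide them. *)
Fixpoint fbounded (m : nat) (a : formula) : bool :=
  match a with
  | fBot => true
  | fEq t u => tbounded m t && tbounded m u
  | fC n t | fRes n _ t => (n <= m) && tbounded m t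
  | fFin t => tbounded m t
  | fImp a b | fAnd a b | fOr a b => fbounded m a && fbounded m b
  | fAll i a | fEx i a => (i < m) && fbounded m a
  end.

Fixpoint qdepth (a : formula) : nat :=
  match a with
  | fImp a b | fAnd a b | fOr a b => maxn (qdepth a) (qdepth b)
  | fAll _ a | fEx _ a => (qdepth a).+1
  | _ => 0
  end.

Definition modulus m : posnat := exist _ m`! (fact_gt0 m).

(* The recurrence is the hypothesis of [osim_split] and [osim_merge], so that
   [precision m d] suffices for [d] nested quantifiers. *)
Definition precision m d := iteri d (fun _ N => 2 * (N + m`!)) m.+1.
(** The cap [N + D] of [osim_merge] for the largest precision in use. *)
Definition cell_bound m := precision m m + m`!.
(** Entries start below [cell_bound m] and at most double under each of at most [m] quantifiers;
    [code_lt] then bounds the code of [2 ^ m] such entries. *)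
Definition state_bound m := 2 ^ (2 ^ m * (cell_bound m * 2 ^ m).+1).

Lemma precision_le m d d' : d <= d' -> precision m d <= precision m d'.
Proof.
move=> /subnK <-; elim: (d' - d) => //= k IHk; apply: leq_trans IHk _.
by rewrite -/(precision m (k + d)); lia.
Qed.

Lemma code_lt s b : all (fun x => x <= b) s -> CodeSeq.code s < 2 ^ (size s *
  b.+1).
Proof.
elim: s => //= x s IHs /andP[lex /IHs lts].
rewrite mulSn expnD; apply: leq_trans (_ : 2 ^ x.+1 * 2 ^ (size s * b.+1) <= _).
  rewrite expnS -mulnA mulnCA ltn_pmul2l ?expn_gt0 // mul2n.
  by rewrite ltn_Sdouble.
by rewrite leq_mul2r leq_pexp2l ?orbT // ltnS.
Qed.

Definition lit_cell m (l : nat -> term) p : term :=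
  foldr (fun i t => tMeet (if bit i p then l i else tCompl (l i)) t) tOne (iota
    0 m).

(** * Cells of a valuation, and the back-and-forth between valuations and codes *)

Section Evaluation.
Variables (M : structure) (M_T3 : models M T3).
Implicit Types (x y z a b c : M).
Local Notation "x ⊓ y" := (iMeet x y) (at level 40, left associativity).
Local Notation "x ⊔ y" := (iJoin x y) (at level 50, left associativity).
Local Notation "x ≼ y" := (le_str x y) (at level 70).
Local Notation "⊥" := (iZero M).
Local Notation "∁ x" := (iCompl x) (at level 35).

Definition cell m (v : nat -> M) p : M :=
  foldr (fun i x => (if bit i p then v i else ∁ (v i)) ⊓ x) (iOne M) (iota 0 m).

Lemma eval_lit_cell m l (v : nat -> M) p :
  eval v (lit_cell m l p) = cell m (fun i => eval v (l i)) p.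
Proof.
by rewrite /lit_cell /cell; elim: (iota 0 m) => //= i s ->; case: (bit i p).
Qed.

Definition pattern m (v : nat -> M) a := num_of_bits m (fun i => `[< a ≼ v i
  >]).

Lemma atom_le_cell m v p a : atom a -> p < 2 ^ m ->
  a ≼ cell m v p <-> pattern m v a = p.
Proof.
move=> ata ltp.
have -> : a ≼ cell m v p <-> forall i, i < m -> bit i p = `[< a ≼ v i >].
  have -> : (forall i, i < m -> bit i p = `[< a ≼ v i >]) <->
      (forall i, i \in iota 0 m -> bit i p = `[< a ≼ v i >]).
    by split=> h i lti; apply: h; move: lti; rewrite mem_iota0.
  rewrite /cell; elim: (iota 0 m) => [|i s IHs] /=; first by split=> // _;
    apply: le_one.
  rewrite le_meet // IHs; split=> [[le_i hs] j|h].
    rewrite inE => /orP[/eqP->|/hs//]; move: le_i.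
    case: (bit i p) => [le_i|]; first by symmetry; apply/asboolP.
    by rewrite atom_le_compl // => /asboolPn/negbTE.
  split=> [|j js]; last by apply: h; rewrite inE js orbT.
  have := h i (mem_head _ _); case: (bit i p) =>
    [/esym/asboolP//|/esym/asboolP].
  by rewrite atom_le_compl.
split=> [h|<- i lti]; last by rewrite bit_num_of_bits.
apply: bit_inj (num_of_bits_lt _ _) ltp _ => i lti.
by rewrite bit_num_of_bits // h.
Qed.

Lemma pattern_lt m v a : pattern m v a < 2 ^ m.
Proof. exact: num_of_bits_lt. Qed.

Lemma atom_le_term m v a t : atom a -> tbounded m t ->
  a ≼ eval v t <-> tval (pattern m v a) t.
Proof.
move=> ata; elim: t => /=.
- by move=> i lti; rewrite bit_num_of_bits //; split=> /asboolP.
- by split=> // /(atom_le0 M_T3 ata).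
- by split=> // _; apply: le_one.
- by move=> t IHt u IHu /andP[/IHt{}IHt /IHu{}IHu]; rewrite le_meet // IHt IHu;
    split=> /andP.
- by move=> t IHt u IHu /andP[/IHt{}IHt /IHu{}IHu];
    rewrite atom_le_join // IHt IHu; split=> /orP.
- by move=> t IHt /IHt{}IHt; rewrite atom_le_compl // IHt; split=> /negP.
Qed.

Lemma big_join_exists n (c : nat -> M) :
  exists x, forall a, atom a -> a ≼ x <-> exists2 p, p < n & a ≼ c p.
Proof.
elim: n => [|n [x hx]]; first by exists ⊥ => a ata;
  split=> [/(atom_le0 M_T3 ata)|[]].
exists (x ⊔ c n) => a ata; rewrite atom_le_join // hx //; split.
  by case=> [[p ltp ap]|an]; [exists p => //; apply: ltnW|exists n].
case=> p; rewrite ltnS leq_eqVlt => /orP[/eqP->|ltp] ap; first by right.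
by left; exists p.
Qed.

Definition cells_sim m D N v s :=
  forall p, p < 2 ^ m -> osim D N (s p) (cell m v p).

Lemma osize_sim m D N v s t : cells_sim m D N v s -> tbounded m t ->
  osim D N (osize m s t) (eval v t).
Proof.
move=> sv bt.
(* A partial sum describes the part of [eval v t] inside the first [n] cells; the next cell is
   disjoint from it, so [osim_join] applies. *)
suff hn n : n <= 2 ^ m -> exists2 x,
    osim D N (\big[oadd/1]_(p < n) if tval p t then s p else 1) x &
    forall a, atom a -> a ≼ x <-> pattern m v a < n /\ tval (pattern m v a) t.
  have [x sx hx] := hn _ (leqnn _); rewrite (_ : eval v t = x) //.
  apply: (atom_ext M_T3) => a ata; rewrite hx // (atom_le_term _ ata bt).
  by split=> [|[]//]; split=> //; apply: pattern_lt.
elim: n => [_|n IHn ltn].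
  rewrite big_ord0; exists ⊥; first exact: osim_bot.
  by move=> a ata; split=> [/(atom_le0 M_T3 ata)|[]].
have [x sx hx] := IHn (ltnW ltn); rewrite big_ord_recr /=.
pose y := if tval n t then cell m v n else ⊥.
have hy a : atom a -> a ≼ y <-> pattern m v a = n /\ tval n t.
  move=> ata; rewrite /y; case: ifP => _; first by rewrite atom_le_cell //;
    split=> [|[]].
  by split=> [/(atom_le0 M_T3 ata)|[]].
exists (x ⊔ y).
  apply: osim_join => //.
    by move=> a ata; rewrite hx // hy // => -[lt _] [eq _];
      rewrite eq ltnn in lt.
  by rewrite /y; case: ifP => _; [apply: sv|apply: osim_bot].
move=> a ata; rewrite atom_le_join // hx // hy //.
rewrite [X in _ <-> is_true X /\ _](_ : _ = (pattern m v a == n) || (pattern m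
  v a < n));
  last by rewrite ltnS leq_eqVlt.
split=> [[[lt tv]|[<- tv]]|[/orP[/eqP eq|lt] tv]]; rewrite ?eqxx ?lt ?orbT //.
  by right; rewrite -eq.
by left.
Qed.

Lemma bit_pairP m i u p : i < m -> u < 2 ^ m -> p < 2 ^ m -> ~~ bit i p ->
  u = p \/ u = p + 2 ^ i <-> forall j, j < m -> j != i -> bit j u = bit j p.
Proof.
move=> ltim ltu ltp nb; split=> [[->|->] // j _ neq|h].
  by rewrite bit_add // (negbTE neq).
case: (boolP (bit i u)) => bu; [right|left]; apply: (@bit_inj m) => //.
- exact: bit_add_lt.
- move=> j ltj; rewrite bit_add //; case: (eqVneq j i) => [->|] //=.
  exact: h.
- move=> j ltj; case: (eqVneq j i) => [->|]; last exact: h.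
  by rewrite (negbTE bu) (negbTE nb).
Qed.

Lemma bit_pattern m v a i : i < m -> bit i (pattern m v a) = `[< a ≼ v i >].
Proof. exact: bit_num_of_bits. Qed.

(** The condition on the right does not involve variable [i]: the join of the pair survives any
    change of its value. *)
Lemma atom_le_pair m v i a p : atom a -> i < m -> p < 2 ^ m -> ~~ bit i p ->
  a ≼ cell m v p ⊔ cell m v (p + 2 ^ i) <->
  forall j, j < m -> j != i -> `[< a ≼ v j >] = bit j p.
Proof.
move=> ata ltim ltp nb; have ltq := bit_add_lt ltim ltp nb.
rewrite atom_le_join // !atom_le_cell // (bit_pairP ltim) //;
  last exact: pattern_lt.
by split=> h j ltj neq; have := h j ltj neq; rewrite bit_pattern.
Qed.

Lemma disjoint_cells m v p q : p < 2 ^ m -> q < 2 ^ m -> p != q ->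
  disjoint (cell m v p) (cell m v q).
Proof.
move=> ltp ltq neq a ata; rewrite !atom_le_cell // => -> eq.
by rewrite eq eqxx in neq.
Qed.

Lemma neq_bit_add i p : p != p + 2 ^ i.
Proof. by rewrite -{1}[p]addn0 eqn_add2l eq_sym -lt0n expn_gt0. Qed.

Lemma cell_pair_sim m D N v s i p : cells_sim m D N v (nthc s) -> i < m ->
    p < 2 ^ m -> ~~ bit i p ->
  osim D N (oadd (nthc s p) (nthc s (p + 2 ^ i)))
    (cell m v p ⊔ cell m v (p + 2 ^ i)).
Proof.
move=> sv ltim ltp nb; have ltq := bit_add_lt ltim ltp nb.
by apply: osim_join; [|apply: disjoint_cells (neq_bit_add i p)|apply: sv|apply:
  sv].
Qed.

Lemma updP m Q i s s' : upd m Q i s s' <-> forall p, p < 2 ^ m -> ~~ bit i p ->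
  [/\ oadd (nthc s' p) (nthc s' (p + 2 ^ i)) = oadd (nthc s p) (nthc s (p + 2 ^
    i)),
      nthc s' p <= maxn (oadd (nthc s p) (nthc s (p + 2 ^ i))) Q
    & nthc s' (p + 2 ^ i) <= maxn (oadd (nthc s p) (nthc s (p + 2 ^ i))) Q].
Proof.
split=> [/allP h p ltp nb|h].
  by have := h p; rewrite mem_iota0 nb => /(_ ltp)/and3P[/eqP].
apply/allP => p; rewrite mem_iota0 => ltp; apply/implyP => nb.
by have [-> -> ->] := h p ltp nb; rewrite eqxx.
Qed.

(** A new value [x] splits the join of every pair of cells, and [osim_merge] describes the two
    halves by numbers with the prescribed sum. *)
Lemma cells_sim_forth m (D : posnat) Q N N' v s i x :
    2 * (N + D) <= N' -> N + D <= Q -> i < m -> cells_sim m D N' v (nthc s) ->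
  exists t, [/\ size t = 2 ^ m, upd m Q i s (CodeSeq.code t) &
    cells_sim m D N (update v i x) (nthc (CodeSeq.code t))].
Proof.
move=> leN' leQ ltim sv; pose v' := update v i x.
have /choice[g hg] p : exists lk : nat * nat, p < 2 ^ m -> ~~ bit i p ->
    let K := oadd (nthc s p) (nthc s (p + 2 ^ i)) in
    [/\ oadd lk.1 lk.2 = K, osim D N lk.1 (cell m v' p),
        osim D N lk.2 (cell m v' (p + 2 ^ i)) & lk.1 <= maxn K Q /\ lk.2 <=
          maxn K Q].
  case: (ltnP p (2 ^ m)) => [ltp|_]; last by exists (0, 0).
  case: (boolP (bit i p)) => [_|nb]; first by exists (0, 0).
  have eqpair : cell m v p ⊔ cell m v (p + 2 ^ i) = cell m v' p ⊔ cell m v' (p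
    + 2 ^ i).
    apply: (atom_ext M_T3) => a ata; rewrite !atom_le_pair //.
    by split=> h j ltj neq; have := h j ltj neq;
      rewrite /v' /update (negbTE neq).
  have := cell_pair_sim sv ltim ltp nb; rewrite eqpair.
  have dpq := disjoint_cells (v := v') ltp (bit_add_lt ltim ltp nb)
    (neq_bit_add i p).
  move=> /(osim_merge M_T3 leN' dpq)[l [k [lk sl sk [lel lek]]]].
  by exists (l, k) => _ _; split=> //=; lia.
(* [g] is indexed by the member of the pair with digit [i] clear; the other member reads the second
   component. *)
pose h r := if bit i r then (g (r - 2 ^ i)).2 else (g r).1.
exists (mkseq h (2 ^ m)); have hE p : p < 2 ^ m -> ~~ bit i p ->
    nthc (CodeSeq.code (mkseq h (2 ^ m))) p = (g p).1 /\
    nthc (CodeSeq.code (mkseq h (2 ^ m))) (p + 2 ^ i) = (g p).2.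
  move=> ltp nb; rewrite !nthc_code !nth_mkseq ?bit_add_lt // /h (negbTE nb).
  by rewrite bit_add // eqxx addnK.
split; first exact: size_mkseq.
  by apply/updP => p ltp nb; have [-> ->] := hE p ltp nb;
    have [-> _ _ []] := hg p ltp nb.
move=> p ltp; case: (boolP (bit i p)) => [bp|nb].
  have [q [ltq nb ->]] := bit_clear ltim ltp bp.
  by have [_ ->] := hE q ltq nb; have [] := hg q ltq nb.
by have [-> _] := hE p ltp nb; have [] := hg p ltp nb.
Qed.

(** Conversely [osim_split] realizes the prescribed halves in every pair, and the new value of
    variable [i] is the join of all second halves. *)
Lemma cells_sim_back m (D : posnat) Q N N' v s s' i :
    2 * (N + D) <= N' -> i < m -> cells_sim m D N' v (nthc s) -> upd m Q i s s'
      ->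
  exists x, cells_sim m D N (update v i x) (nthc s').
Proof.
move=> leN' ltim sv /updP upds.
have /choice[g hg] p : exists yz : M * M, p < 2 ^ m -> ~~ bit i p ->
    [/\ disjoint yz.1 yz.2, yz.1 ⊔ yz.2 = cell m v p ⊔ cell m v (p + 2 ^ i),
        osim D N (nthc s' p) yz.1 & osim D N (nthc s' (p + 2 ^ i)) yz.2].
  case: (ltnP p (2 ^ m)) => [ltp|_]; last by exists (⊥, ⊥).
  case: (boolP (bit i p)) => [_|nb]; first by exists (⊥, ⊥).
  have := cell_pair_sim sv ltim ltp nb; have [<- _ _] := upds p ltp nb.
  by move=> /(osim_split M_T3 leN')[y [z [dyz yz sy sz]]]; exists (y, z).
have [x hx] := big_join_exists (2 ^ m) (fun p => if bit i p then ⊥ else (g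
  p).2).
exists x; pose v' := update v i x.
have in_pair p a : atom a -> p < 2 ^ m -> ~~ bit i p -> a ≼ (g p).1 \/ a ≼ (g
  p).2 <->
    forall j, j < m -> j != i -> `[< a ≼ v j >] = bit j p.
  move=> ata ltp nb; have [_ yz _ _] := hg p ltp nb.
  by rewrite -atom_le_join // yz atom_le_pair.
(* [x] is a join over all pairs, but distinct pairs are disjoint, so inside pair [p] only its own
   second half counts. *)
have le_x p a : atom a -> p < 2 ^ m -> ~~ bit i p -> a ≼ (g p).1 \/ a ≼ (g p).2
  ->
    a ≼ x <-> a ≼ (g p).2.
  move=> ata ltp nb ap; rewrite hx //; split=> [[q ltq]|]; last first.
    by exists p => //; rewrite (negbTE nb).
  case: (boolP (bit i q)) => [_ /(atom_le0 M_T3 ata)//|nbq aq].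
  suff -> : p = q by [].
  have /in_pair hp := ap; have /in_pair hq : a ≼ (g q).1 \/ a ≼ (g q).2 by
    right.
  apply: (@bit_inj m) => // j ltj; case: (eqVneq j i) => [->|neq].
    by rewrite (negbTE nb) (negbTE nbq).
  by rewrite -hp // -hq.
have cellE p : p < 2 ^ m -> ~~ bit i p ->
    cell m v' p = (g p).1 /\ cell m v' (p + 2 ^ i) = (g p).2.
  move=> ltp nb; have ltq := bit_add_lt ltim ltp nb;
    have [dyz _ _ _] := hg p ltp nb.
  have cell_r r a : atom a -> r < 2 ^ m -> r = p \/ r = p + 2 ^ i ->
      a ≼ cell m v' r <->
      (a ≼ (g p).1 \/ a ≼ (g p).2) /\ `[< a ≼ x >] = bit i r.
    move=> ata ltr /(bit_pairP ltim ltr ltp nb) hr.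
    have hb j : j < m ->
        bit j (pattern m v' a) = if j == i then `[< a ≼ x >] else `[< a ≼ v j
          >].
      by move=> ltj; rewrite bit_pattern // /v' /update; case: eqP.
    rewrite atom_le_cell // in_pair //; split=> [eqr|[h hi]].
      split=> [j ltj neq|]; last by rewrite -eqr hb // eqxx.
      by rewrite -hr // -eqr hb // (negbTE neq).
    apply: bit_inj (pattern_lt _ _ _) ltr _ => j ltj; rewrite hb //.
    by case: eqP => [->//|/eqP neq]; rewrite hr // h.
  split; apply: (atom_ext M_T3) => a ata.
    rewrite cell_r //; last by left.
    rewrite (negbTE nb); split=> [[h /asboolP nax]|ay].
      by case: h (le_x p a ata ltp nb h) => // az [_ /(_ az)].
    split; first by left.
    apply/asboolP => /(le_x p a ata ltp nb (or_introl ay)); exact: dyz ay.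
  rewrite cell_r //; last by right.
  rewrite bit_add // eqxx; split=> [[h /asboolP/(le_x p a ata ltp nb h)]|az] //.
  by split; [right|apply/asboolP/(le_x p a ata ltp nb (or_intror az))].
move=> p ltp; case: (boolP (bit i p)) => [bp|nb].
  have [q [ltq nb ->]] := bit_clear ltim ltp bp.
  by have [_ ->] := cellE q ltq nb; have [] := hg q ltq nb.
by have [-> _] := cellE p ltp nb; have [] := hg p ltp nb.
Qed.
End Evaluation.

Lemma code_lt_state_bound m t :
  size t = 2 ^ m -> all (fun k => k <= cell_bound m * 2 ^ m) t ->
  CodeSeq.code t < state_bound m.
Proof. by move=> st /code_lt; rewrite st. Qed.

Lemma code_bounded m t b : size t = 2 ^ m ->
  (forall p, p < 2 ^ m -> nthc (CodeSeq.code t) p <= b) -> all (fun k => k <=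
    b) t.
Proof.
move=> st h; apply/(all_nthP 0) => p; rewrite st => /h.
by rewrite nthc_code.
Qed.

(** Two entries are added before being split again, hence the factor 2. *)
Lemma upd_bounded m Q i s s' b : i < m -> Q <= 2 * b -> upd m Q i s s' ->
  (forall p, p < 2 ^ m -> nthc s p <= b) ->
  forall p, p < 2 ^ m -> nthc s' p <= 2 * b.
Proof.
move=> ltim leQ /updP us hs.
have le2 p : p < 2 ^ m -> ~~ bit i p ->
    maxn (oadd (nthc s p) (nthc s (p + 2 ^ i))) Q <= 2 * b.
  move=> ltp nb; have := hs _ ltp; have := hs _ (bit_add_lt ltim ltp nb).
  by rewrite /oadd; case: ifP; lia.
move=> p ltp; case: (boolP (bit i p)) => [bp|nb].
  have [q [ltq nb ->]] := bit_clear ltim ltp bp.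
  by have [_ _ le_q] := us q ltq nb; apply: leq_trans le_q (le2 _ ltq nb).
by have [_ le_p _] := us p ltp nb; apply: leq_trans le_p (le2 _ ltp nb).
Qed.

Definition evm m := ev m (cell_bound m) (state_bound m).

(** * Truth in a model computed from the codes *)

Section Truth.
Variables (M : structure) (M_T3 : models M T3) (m : nat).
Implicit Types (x : M) (v : nat -> M).
Local Notation "x ≼ y" := (le_str x y) (at level 70).
Local Notation "⊥" := (iZero M).
Local Notation D := (modulus m).
Local Notation sims d := (cells_sim m D (precision m d)).

Let v0 : nat -> M := fun=> ⊥.
Let ax phi (Tphi : T3 phi) := M_T3 Tphi v0.

Lemma modulus_dvd (n : posnat) : n <= m -> n %| D.
Proof. by move=> lenm; apply: dvdn_fact; rewrite lenm andbT;
  apply: (valP n). Qed.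

Lemma osim_atleast N (n : posnat) k x : n <= N -> osim D N k x ->
  iC n x <-> (k == 0) || (n < k).
Proof.
move=> leN; rewrite (iC_at_least M_T3); case: k => [|k] /=.
  by move=> nFx; split=> // _; apply: at_least_notfin.
by case=> _ _; apply.
Qed.

Lemma osim_fin N k x : osim D N k x -> iFin x <-> k != 0.
Proof. by case: k => [|k] //= [Fx _ _]; split. Qed.

Lemma int_congrP n r k : int_congr n r k <-> ((k : int) = r %[mod n])%Z.
Proof.
case: r => j /=.
  by rewrite !modz_nat; split=> [/eqP->//|[->]].
rewrite -[_ == 0]/(n %| k + j.+1); have -> : (n %| k + j.+1) = ((k : int) ==
  Negz j %[mod n])%Z.
  by rewrite eqz_mod_dvd NegzE GRing.opprK -PoszD.
by split=> /eqP.
Qed.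

(** The residue is known modulo [m!]; the divisibility axiom passes it to [n], and disjointness of
    residues excludes the others. *)
Lemma osim_res N (n : posnat) r k x : n <= m -> osim D N k x ->
  iRes n r x <-> (k != 0) && int_congr n r k.-1.
Proof.
move=> lenm; case: k => [|k] /=.
  by move=> nFx; split=> // /(ax (ax_Res_Fin n r) x).
move=> [Fx /(ax (ax_Res_dvd k%:Z (modulus_dvd lenm)) x) rx _].
split=> [rx'|/int_congrP/ax_Res_cong h]; last exact: (ax h x).
apply/int_congrP; apply: contrapT => /ax_Res_disj h.
exact: (ax h x rx rx').
Qed.

Lemma osim_eq0 N k x : 0 < N -> osim D N k x -> x = ⊥ <-> k == 1.
Proof.
move=> N_gt0; case: k => [|k] /= sx.
  by split=> // x0; case: sx; rewrite x0; apply: (ax ax_Fin0).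
have [_ _ /(_ 1 N_gt0) c1] := sx; split=> [x0|].
  by rewrite eqSS -leqn0 leqNgt; apply/negP => /c1/(at_least1 M_T3).
by case: k {sx} c1 => // c1 _; apply: contrapT => /(at_least1 M_T3)/c1.
Qed.

Lemma eval_eq_cells N v s t u : 0 < N -> cells_sim m D N v s ->
    tbounded m t -> tbounded m u ->
  eval v t = eval v u <->
    all (fun p => (tval p t != tval p u) ==> (s p == 1)) (iota 0 (2 ^ m)).
Proof.
move=> N_gt0 sv bt bu; split=> [eqtu|/allP h].
  apply/allP => p; rewrite mem_iota0 => ltp; apply/implyP => neq.
  apply/(osim_eq0 N_gt0 (sv p ltp)); apply: (atom_ext M_T3) => a ata.
  split=> [|/(atom_le0 M_T3 ata)//]; rewrite atom_le_cell // => eqp.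
  have := atom_le_term M_T3 v ata bt; rewrite eqtu (atom_le_term M_T3 v ata bu)
    eqp.
  by move: neq; case: (tval p t) (tval p u) => -[] // _ [h1 h2];
    case: (h1 isT) || case: (h2 isT).
apply: (atom_ext M_T3) => a ata; rewrite (atom_le_term M_T3 v ata bt)
  (atom_le_term M_T3 v ata bu).
suff -> : tval (pattern m v a) t = tval (pattern m v a) u by [].
apply: contrapT => /eqP neq; have ltp := pattern_lt m v a.
have := h (pattern m v a); rewrite mem_iota0 neq => /(_ ltp) /=.
move/(osim_eq0 N_gt0 (sv _ ltp)) => c0.
by apply: (atom_le0 M_T3 ata); rewrite -c0 atom_le_cell.
Qed.

Lemma precision_bound d : d <= m -> precision m d + D <= cell_bound m.
Proof. by move=> led; rewrite leq_add2r precision_le. Qed.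

(** [d] counts the quantifiers still allowed for and [b] bounds the entries of the state. A
    quantifier lowers [d] by one, which costs one step of the precision recurrence, and doubles [b];
    so [b * 2 ^ d] is preserved. Its bound ensures that the state found by [cells_sim_forth] lies in
    the range searched by [ev]. *)
Theorem ev_sat a d s v b : fbounded m a -> qdepth a <= d -> d <= m ->
    sims d v (nthc s) -> (forall p, p < 2 ^ m -> nthc s p <= b) ->
    cell_bound m <= b -> b * 2 ^ d <= cell_bound m * 2 ^ m ->
  sat v a <-> evm m a s.
Proof.
(* The precision starts at [m.+1], so at any depth it decides the counts up to [m] and the emptiness
   of a cell. *)
have lt_mN d' : m < precision m d' by apply: (precision_le m (leq0n d')).
elim: a d s v b => /=.
- by [].
- move=> t u d s v b /andP[bt bu] _ _ sv _ _ _.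
  by apply: (eval_eq_cells (N := precision m d)) => //;
    apply: leq_ltn_trans (lt_mN d).
- move=> n t d s v b /andP[len bt] _ _ sv _ _ _.
  apply: (osim_atleast (N := precision m d)); first exact: leq_trans (ltnW
    (lt_mN d)).
  exact: osize_sim.
- move=> t d s v b bt _ _ sv _ _ _.
  by apply: (osim_fin (N := precision m d)); apply: osize_sim.
- move=> n r t d s v b /andP[len bt] _ _ sv _ _ _.
  by apply: (osim_res (N := precision m d)) => //; apply: osize_sim.
- move=> a IHa c IHc d s v b /andP[ba bc]; rewrite geq_max => /andP[da dc] dm
    sv hs Qb bB.
  by rewrite (IHa d s v b) // (IHc d s v b) //; split=> /implyP.
- move=> a IHa c IHc d s v b /andP[ba bc]; rewrite geq_max => /andP[da dc] dm
    sv hs Qb bB.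
  by rewrite (IHa d s v b) // (IHc d s v b) //; split=> /andP.
- move=> a IHa c IHc d s v b /andP[ba bc]; rewrite geq_max => /andP[da dc] dm
    sv hs Qb bB.
  by rewrite (IHa d s v b) // (IHc d s v b) //; split=> /orP.
all: move=> i a IHa [//|d] s v b /andP[ltim ba];
  rewrite ltnS => da dm sv hs Qb bB.
all: have Qd := precision_bound (ltnW dm).
all: have leN : 2 * (precision m d + D) <= precision m d.+1 by [].
all: have bB' : 2 * b * 2 ^ d <= cell_bound m * 2 ^ m by rewrite expnS in bB;
  lia.
all: have Qb' : cell_bound m <= 2 * b by lia.
all: have IH x s' : upd m (cell_bound m) i s s' -> sims d (update v i x) (nthc
  s') ->
      sat (update v i x) a <-> evm m a s'
  by move=> us sx; apply: (IHa d s' _ (2 * b)) => //;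
    [exact: ltnW|exact: upd_bounded us hs].
all: have back s' : upd m (cell_bound m) i s s' ->
      exists2 x, sims d (update v i x) (nthc s') & sat (update v i x) a <-> evm
        m a s'
  by move=> us; have [x sx] := cells_sim_back M_T3 leN ltim sv us;
    exists x => //; apply: IH.
all: have forth x : exists s', [/\ s' < state_bound m, upd m (cell_bound m) i s
  s'
      & sat (update v i x) a <-> evm m a s']; first (
  have [t [st us sx]] := cells_sim_forth M_T3 x leN Qd ltim sv;
  exists (CodeSeq.code t); split; [|by []|exact: IH];
  apply: code_lt_state_bound (st) _; apply: code_bounded (st) _ => p ltp;
  apply: leq_trans (upd_bounded ltim Qb' us hs ltp) _;
  by apply: leq_trans bB'; rewrite leq_pmulr // expn_gt0).
- split=> [h|/allP h x].
    apply/allP => s' _; apply/implyP => us.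
    by have [x _ <-] := back s' us; apply: h.
  have [s' [lts' us ->]] := forth x.
  by have := h s'; rewrite mem_iota0 us => /(_ lts').
- split=> [[x]|/hasP[s' _ /andP[us ea]]].
    have [s' [lts' us ->]] := forth x => ea.
    by apply/hasP; exists s'; rewrite ?mem_iota0 ?us.
  by have [x _ hx] := back s' us; exists x; apply/hx.
Qed.

End Truth.

(** * Goedel numbers as bounds, and dependence on free variables *)

Lemma tbounded_le m m' t : m <= m' -> tbounded m t -> tbounded m' t.
Proof.
move=> le_mm'; elim: t => //= [i lti|t IHt u IHu|t IHt u IHu].
- exact: leq_trans lti le_mm'.
- by case/andP=> /IHt-> /IHu->.
- by case/andP=> /IHt-> /IHu->.
Qed.

Lemma fbounded_le m m' a : m <= m' -> fbounded m a -> fbounded m' a.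
Proof.
move=> le_mm'; elim: a => //=.
- by move=> t u /andP[bt bu]; rewrite !(tbounded_le le_mm').
- by move=> n t /andP[ln bt]; rewrite (leq_trans ln) ?(tbounded_le le_mm').
- by move=> t; apply: tbounded_le.
- by move=> n r t /andP[ln bt]; rewrite (leq_trans ln) ?(tbounded_le le_mm').
- by move=> a IHa b IHb /andP[/IHa-> /IHb->].
- by move=> a IHa b IHb /andP[/IHa-> /IHb->].
- by move=> a IHa b IHb /andP[/IHa-> /IHb->].
- by move=> i a IHa /andP[lti /IHa->]; rewrite (leq_trans lti).
- by move=> i a IHa /andP[lti /IHa->]; rewrite (leq_trans lti).
Qed.

Lemma tbounded_goedel t : tbounded (goedel_term t) t.
Proof.
elim: t => [i|||t IHt u IHu|t IHt u IHu|t IHt] //.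
- by have /and3P[] := CodeSeq.ltn_code [:: 0; i].
- have /and4P[_ lt lu _] := CodeSeq.ltn_code [:: 3; goedel_term t;
    goedel_term u].
  by rewrite [tbounded _ _]/= !(tbounded_le (ltnW _) IHt, tbounded_le (ltnW _)
    IHu).
- have /and4P[_ lt lu _] := CodeSeq.ltn_code [:: 4; goedel_term t;
    goedel_term u].
  by rewrite [tbounded _ _]/= !(tbounded_le (ltnW _) IHt, tbounded_le (ltnW _)
    IHu).
- have /and3P[_ lt _] := CodeSeq.ltn_code [:: 5; goedel_term t].
  exact: tbounded_le (ltnW lt) IHt.
Qed.

(** The code of a list exceeds all its entries, so one number bounds the variables, the indices and,
    growing with each quantifier, the depth. *)
Lemma bounded_goedel a : fbounded (goedel a) a /\ qdepth a <= goedel a.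
Proof.
have bt m t : goedel_term t < m -> tbounded m t.
  by move=> lt; apply: tbounded_le (ltnW lt) (tbounded_goedel t).
elim: a => [|t u|n t|t|n r t|a [IHa da] b [IHb db]|a [IHa da] b [IHb db]
  |a [IHa da] b [IHb db]|i a [IHa da]|i a [IHa da]]; first by [].
- split=> //; have /and4P[_ lt lu _] := CodeSeq.ltn_code [:: 1; goedel_term t;
    goedel_term u].
  by rewrite [fbounded _ _]/= !bt.
- split=> //; have /and4P[_ ln lt _] := CodeSeq.ltn_code [:: 2; posnat_val n;
    goedel_term t].
  by rewrite [fbounded _ _]/= (ltnW ln) bt.
- split=> //; have /and3P[_ lt _] := CodeSeq.ltn_code [:: 3; goedel_term t].
  exact: bt.
- split=> //; have /and5P[_ ln _ lt _] :=
    CodeSeq.ltn_code [:: 4; posnat_val n; goedel_int r; goedel_term t].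
  by rewrite [fbounded _ _]/= (ltnW ln) bt.
- have /and4P[_ la lb _] := CodeSeq.ltn_code [:: 5; goedel a; goedel b].
  rewrite [fbounded _ _]/= (fbounded_le (ltnW la)) // (fbounded_le (ltnW lb))
    //.
  by rewrite geq_max (leq_trans da (ltnW la)) (leq_trans db (ltnW lb)).
- have /and4P[_ la lb _] := CodeSeq.ltn_code [:: 6; goedel a; goedel b].
  rewrite [fbounded _ _]/= (fbounded_le (ltnW la)) // (fbounded_le (ltnW lb))
    //.
  by rewrite geq_max (leq_trans da (ltnW la)) (leq_trans db (ltnW lb)).
- have /and4P[_ la lb _] := CodeSeq.ltn_code [:: 7; goedel a; goedel b].
  rewrite [fbounded _ _]/= (fbounded_le (ltnW la)) // (fbounded_le (ltnW lb))
    //.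
  by rewrite geq_max (leq_trans da (ltnW la)) (leq_trans db (ltnW lb)).
- have /and4P[_ li la _] := CodeSeq.ltn_code [:: 8; i; goedel a].
  split; last exact: leq_ltn_trans da la.
  by rewrite [fbounded _ _]/= li (fbounded_le (ltnW la)).
- have /and4P[_ li la _] := CodeSeq.ltn_code [:: 9; i; goedel a].
  split; last exact: leq_ltn_trans da la.
  by rewrite [fbounded _ _]/= li (fbounded_le (ltnW la)).
Qed.

Lemma eval_ext (M : structure) (v w : nat -> M) t :
  (forall i, occurs i t -> v i = w i) -> eval v t = eval w t.
Proof.
elim: t => //= [i|t IHt u IHu|t IHt u IHu|t IHt] h.
- by apply: h.
- by rewrite IHt ?IHu // => i oi; apply: h; rewrite oi ?orbT.
- by rewrite IHt ?IHu // => i oi; apply: h; rewrite oi ?orbT.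
- by rewrite IHt.
Qed.

Lemma sat_ext (M : structure) (v w : nat -> M) a :
  (forall i, free_in i a -> v i = w i) -> sat v a <-> sat w a.
Proof.
have upd_ext (v' w' : nat -> M) i c d :
    (forall j, (j != i) && free_in j c -> v' j = w' j) ->
    forall j, free_in j c -> update v' i d j = update w' i d j.
  by move=> h j fj; rewrite /update; case: eqP => // /eqP neq; apply: h;
    rewrite neq.
elim: a v w => /=.
- by [].
- move=> t u v w h.
  by rewrite (@eval_ext _ v w t) ?(@eval_ext _ v w u) // => i oi; apply: h;
    rewrite oi ?orbT.
- by move=> n t v w h; rewrite (@eval_ext _ v w t).
- by move=> t v w h; rewrite (@eval_ext _ v w t).
- by move=> n r t v w h; rewrite (@eval_ext _ v w t).
- move=> a IHa b IHb v w h.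
  by rewrite (IHa v w) ?(IHb v w) // => i oi; apply: h; rewrite oi ?orbT.
- move=> a IHa b IHb v w h.
  by rewrite (IHa v w) ?(IHb v w) // => i oi; apply: h; rewrite oi ?orbT.
- move=> a IHa b IHb v w h.
  by rewrite (IHa v w) ?(IHb v w) // => i oi; apply: h; rewrite oi ?orbT.
- move=> i a IHa v w h; split=> hd d.
    by apply/(IHa _ (update v i d)); [apply: upd_ext => j /h|apply: hd].
  by apply/(IHa _ (update w i d)); [apply: upd_ext => j /h|apply: hd].
- move=> i a IHa v w h; split=> -[d hd]; exists d.
    by apply/(IHa _ (update v i d)); [apply: upd_ext => j /h|apply: hd].
  by apply/(IHa _ (update w i d)); [apply: upd_ext => j /h|apply: hd].
Qed.

(** * Sentences and completeness *)

Definition init_state m := CodeSeq.code (mkseq (fun p => nat_of_bool (p != 0))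
  (2 ^ m)).

Lemma nthc_init_state m p : p < 2 ^ m -> nthc (init_state m) p = (p != 0).
Proof. by move=> ltp; rewrite nthc_code nth_mkseq. Qed.

Lemma bit0 i : bit i 0 = false. Proof. by elim: i. Qed.

(** With all variables at [⊥], cell 0 is the whole algebra, which is not in [Fin] (code 0), and the
    other cells are empty (code 1). *)
Lemma cells_sim_init (M : structure) (M_T3 : models M T3) m D N :
  cells_sim m D N (fun=> iZero M) (nthc (init_state m)).
Proof.
move=> p ltp; rewrite nthc_init_state //; case: eqP => [->|/eqP p0] /=.
  rewrite (_ : cell _ _ _ = iOne M); first exact: (M_T3 _ ax_Fin_proper (fun=>
    iZero M)).
  apply: (atom_ext M_T3) => a ata; rewrite atom_le_cell ?expn_gt0 //.
  split=> _; first exact: le_one.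
  apply: (@bit_inj m); rewrite ?pattern_lt ?expn_gt0 // => i lti.
  by rewrite bit_pattern // bit0; apply/asboolPn/(atom_le0 M_T3).
rewrite (_ : cell _ _ _ = iZero M); first exact: osim_bot.
apply: (atom_ext M_T3) => a ata; rewrite atom_le_cell //.
split=> [patp|/(atom_le0 M_T3 ata)//]; case/negP: p0; apply/eqP.
apply: (@bit_inj m); rewrite ?expn_gt0 // => i lti.
by rewrite -patp bit_pattern // bit0; apply/asboolPn/(atom_le0 M_T3).
Qed.

Lemma sentence_ev a m (M : structure) (v : nat -> M) : models M T3 ->
  sentence a -> fbounded m a -> qdepth a <= m -> sat v a <-> evm m a
    (init_state m).
Proof.
move=> M_T3 sa ba da; rewrite (@sat_ext _ v (fun=> iZero M)); last first.
  by move=> i; rewrite (negbTE (sa i)).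
apply: (ev_sat M_T3 ba da (leqnn m) (cells_sim_init M_T3 _ _) (b := cell_bound
  m)) => //.
move=> p ltp; rewrite nthc_init_state //; case: eqP => // _.
by rewrite /cell_bound addn_gt0 fact_gt0 orbT.
Qed.

(** Neither [evm] nor the initial state mentions the model, so one computation settles the sentence
    in all models at once. *)
Lemma entails_dichotomy a : sentence a -> entails T3 a \/ entails T3 (fNot a).
Proof.
move=> sa; have [ba da] := bounded_goedel a.
case ea: (evm (goedel a) a (init_state (goedel a))); [left|right] => M M_T3 v.
  by apply/(sentence_ev v M_T3 sa ba da); rewrite ea.
by move/(sentence_ev v M_T3 sa ba da); rewrite ea.
Qed.

(** * Quantifier elimination *)

Lemma quantifier_free_big (op : formula -> formula -> formula) idx n (P : pred
  'I_n) F :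
  quantifier_free idx ->
  (forall a b, quantifier_free (op a b) = quantifier_free a && quantifier_free
    b) ->
  (forall j, quantifier_free (F j)) ->
  quantifier_free (\big[op/idx]_(j < n | P j) F j).
Proof.
move=> qidx qop qF; apply: (big_ind quantifier_free) => // a b qa qb.
by rewrite qop qa.
Qed.

Lemma free_in_big (op : formula -> formula -> formula) idx n (P : pred 'I_n) F
  i :
  ~~ free_in i idx ->
  (forall a b, free_in i (op a b) = free_in i a || free_in i b) ->
  (forall j, ~~ free_in i (F j)) ->
  ~~ free_in i (\big[op/idx]_(j < n | P j) F j).
Proof.
move=> fidx fop fF; apply: (big_ind (fun a => ~~ free_in i a)) => // a b fa fb.
by rewrite fop negb_or fa.
Qed.

(** The first-order counterpart of [osim]. Conjunct [j] concerns the count [j.+1], so [j < k] reads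
    [j.+1 <= k]; the count 0 holds trivially. *)
Definition sim_formula (D : posnat) N kappa (t : term) : formula :=
  if kappa is k.+1 then
    fAnd (fFin t) (fAnd (fRes D k t)
      (\big[fAnd/fTop]_(j < N)
        if j < k then fC (succ_pos j) t else fNot (fC (succ_pos j) t)))
  else fNot (fFin t).

Lemma sat_sim_formula (M : structure) (M_T3 : models M T3) (D : posnat) N k (v
  : nat -> M) t :
  sat v (sim_formula D N k t) <-> osim D N k (eval v t).
Proof.
case: k => [|k] //=; rewrite sat_bigand; split=> [[Ft [rt ht]]|[Ft rt ht]].
  split=> // -[_|j ltj]; first by split=> // _; apply: at_least0.
  have := ht (Ordinal ltj) isT; rewrite /=; case: ltnP => _ /=.
    by move/(iC_at_least M_T3 (succ_pos j)).
  by move=> nC; split=> // /(iC_at_least M_T3 (succ_pos j)).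
split=> //; split=> // j _; have := ht j.+1 (ltn_ord j); case: ltnP => _ /= h.
  by apply/(iC_at_least M_T3 (succ_pos j))/h.
by move/(iC_at_least M_T3 (succ_pos j))/h.
Qed.

(** Cells are cut out by all [m] variables, but only those free in [a] may occur in the result; the
    others are set to zero, which does not affect the truth of [a]. *)
Definition literal (a : formula) (i : nat) : term :=
  if free_in i a then tVar i else tZero.

(** The states listed are those accepted by [evm] whose entries satisfy the bound of [ev_sat] at
    depth [m]. *)
Definition qe_formula m (a : formula) : formula :=
  \big[fOr/fBot]_(s < state_bound m | evm m a s &&
      all (fun p => nthc s p <= cell_bound m) (iota 0 (2 ^ m)))
    \big[fAnd/fTop]_(p < 2 ^ m)
      sim_formula (modulus m) (precision m m) (nthc s p) (lit_cell m (literal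
        a) p).

Lemma quantifier_free_qe m a : quantifier_free (qe_formula m a).
Proof.
apply: quantifier_free_big => // s; apply: quantifier_free_big => // p.
rewrite /sim_formula; case: (nthc s p) => //= k.
by apply: quantifier_free_big => // j; case: ifP.
Qed.

Lemma free_in_qe m a i : free_in i (qe_formula m a) -> free_in i a.
Proof.
apply: contraTT => nfi; apply: free_in_big => // s; apply: free_in_big => // p.
have no : ~~ occurs i (lit_cell m (literal a) p).
  rewrite /lit_cell; elim: (iota 0 m) => //= j r IHr; rewrite negb_or IHr andbT.
  have nl : ~~ occurs i (literal a j).
    by rewrite /literal; case: ifP => //= fj; apply: contra nfi => /eqP->.
  by case: (bit j p).
rewrite /sim_formula; case: (nthc s p) => [|k] /=; first by rewrite orbF.
rewrite !negb_or no /=; apply: free_in_big => // j; case: ifP => _ //=.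
by rewrite orbF.
Qed.

Lemma sat_qe_formula m a (M : structure) (v : nat -> M) : models M T3 ->
  fbounded m a -> qdepth a <= m -> sat v (qe_formula m a) <-> sat v a.
Proof.
move=> M_T3 ba da; pose w i := eval v (literal a i).
have -> : sat v a <-> sat w a.
  by apply: sat_ext => i fi; rewrite /w /literal fi.
have satE s : all (fun p => nthc s p <= cell_bound m) (iota 0 (2 ^ m)) ->
    cells_sim m (modulus m) (precision m m) w (nthc s) -> sat w a <-> evm m a s.
  move=> /allP hs ws; apply: (ev_sat M_T3 ba da (leqnn m) ws (b := cell_bound
    m)) => //.
  by move=> p ltp; apply: hs; rewrite mem_iota0.
rewrite sat_bigor; split=> [[s /andP[es hs] /sat_bigand h]|wa].
  apply/(satE s) => // p ltp; have := h (Ordinal ltp) isT.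
  by rewrite (sat_sim_formula M_T3) eval_lit_cell.
(* Every valuation fits a listed state: [sim_exists] gives a representative below [cell_bound m] for
   each cell in [Fin]. *)
have /choice[g hg] p : exists k, k <= cell_bound m /\
    osim (modulus m) (precision m m) k (cell m w p).
  case: (EM (iFin (cell m w p))) => [Fp|nFp]; last by exists 0.
  by have [k ltk sk] := sim_exists M_T3 (modulus m) (precision m m) Fp;
    exists k.+1.
pose t := mkseq g (2 ^ m).
have hs : all (fun k => k <= cell_bound m) t.
  by apply/allP => _ /mapP[p _ ->]; have [] := hg p.
have lts : CodeSeq.code t < state_bound m.
  apply: code_lt_state_bound; first exact: size_mkseq.
  by apply: sub_all hs => k lek; apply: leq_trans lek _;
    rewrite leq_pmulr ?expn_gt0.
have tE p : p < 2 ^ m -> nthc (CodeSeq.code t) p = g p.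
  by move=> ltp; rewrite nthc_code nth_mkseq.
have ht : all (fun p => nthc (CodeSeq.code t) p <= cell_bound m) (iota 0 (2 ^
  m)).
  by apply/allP => p; rewrite mem_iota0 => ltp; rewrite tE //; have [] := hg p.
have simt : cells_sim m (modulus m) (precision m m) w (nthc (CodeSeq.code t)).
  by move=> p ltp; rewrite tE //; have [] := hg p.
exists (Ordinal lts); first by rewrite ht andbT; apply/(satE _ ht simt).
apply/sat_bigand => p _; apply/(sat_sim_formula M_T3).
by rewrite eval_lit_cell; apply: simt.
Qed.

Lemma T3_quantifier_elimination : quantifier_elimination T3.
Proof.
move=> a; have [ba da] := bounded_goedel a.
exists (qe_formula (goedel a) a); split.
- exact: quantifier_free_qe.
- by move=> i; apply: free_in_qe.
- by move=> M M_T3 v; have [h1 h2] := sat_qe_formula v M_T3 ba da; split.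
Qed.

(** * Powerset algebras *)

(** A nonempty [A] forces [U] to be inhabited, so the injection can be taken to be a total
    function. *)
Lemma card_le_inj (T U : Type) (A : set T) (B : set U) :
  (A #<= B)%card -> A !=set0%classic ->
  exists f : T -> U, (forall x, A x -> B (f x)) /\
    forall x y, A x -> A y -> f x = f y -> x = y.
Proof.
elim/Ppointed: U => U in B *.
  by rewrite [B]empty_eq0 card_le0 => /eqP-> [].
move=> /pcard_leP[f] _; exists f; split=> [x Ax|x y Ax Ay]; first exact: funS.
by apply: inj; rewrite inE.
Qed.

Section CardSeq.
Variable T : choiceType.
Local Open Scope classical_set_scope.
Local Open Scope card_scope.
Implicit Types (A B : set T) (s : seq T).

Lemma card_seq s : uniq s -> [set` s] #= `I_(size s).
Proof.
case: s => [|x0 s'] us; first by rewrite II0 set_nil card_eq0.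
move: us; set s := x0 :: s' => us.
have -> : [set` s] = nth x0 s @` `I_(size s).
  rewrite predeqE => x; split=> [/(nthP x0)[i lti <-]|[i lti <-]];
    last exact: mem_nth.
  by exists i.
apply: inj_card_eq => i j; rewrite !in_setE => lti ltj eqn.
by apply/eqP; rewrite -(nth_uniq x0 lti ltj us) eqn.
Qed.

Lemma card_eq_seqP A k : A #= `I_k <->
  exists s, [/\ uniq s, size s = k & A = [set` s]].
Proof.
split=> [cA|[s [us <- ->]]]; last exact: card_seq.
have [s As] : exists s : seq T, A = [set` s].
  by apply/finite_seqP/finite_setP; exists k.
have {}As : A = [set` undup s].
  by rewrite As predeqE => x; rewrite /= mem_undup.
exists (undup s); split=> //; first exact: undup_uniq.
apply/(@card_eq_II _ _); apply: card_eq_trans cA; rewrite As card_eq_sym.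
by apply: card_seq; apply: undup_uniq.
Qed.

Lemma card_le_seqP n A : `I_n #<= A <->
  exists s, [/\ uniq s, size s = n & forall x, x \in s -> A x].
Proof.
split=> [leA|[s [us <- sA]]].
  case: n leA => [|n] leA; first by exists [::].
  have [|f [fA f_inj]] := card_le_inj leA; first by exists 0.
  exists (mkseq f n.+1); split; last 1 first.
  - by move=> _ /mapP[i + ->]; rewrite mem_iota0 => lti; apply: fA.
  - rewrite map_inj_in_uniq ?iota_uniq // => i j; rewrite !mem_iota0 => lti ltj.
    exact: f_inj.
  - exact: size_mkseq.
have := card_seq us; rewrite card_eq_le => /andP[_ le_s].
by apply: card_le_trans le_s _; apply: subset_card_le => x; apply: sA.
Qed.

Lemma card_eq_disjointU A B k l : A #= `I_k -> B #= `I_l -> A `&` B = set0 ->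
  A `|` B #= `I_(k + l).
Proof.
move=> /card_eq_seqP[s [us <- ->]] /card_eq_seqP[t [ut <- ->]] dst.
apply/card_eq_seqP; exists (s ++ t); split; last 1 first.
- by rewrite predeqE => x /=; rewrite mem_cat; split=> [[->|->]|/orP];
    rewrite ?orbT.
- rewrite cat_uniq us ut andbT; apply/hasPn => x xt; apply/negP => xs.
  by have : ([set` s] `&` [set` t]) x by []; rewrite dst.
- exact: size_cat.
Qed.

(** The Main Axiom for powersets: the even and the odd terms of an injective sequence in [A] are
    separated. *)
Lemma infinite_split A : infinite_set A -> exists B,
  [/\ B `<=` A, infinite_set B & infinite_set (A `\` B)].
Proof.
move=> /infiniteP/card_le_inj[|f [fA f_inj]]; first by exists 0.
have inf_im (g : nat -> nat) : injective g -> infinite_set ((f \o g) @` [set: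
  nat]).
  move=> g_inj; apply/infiniteP; have : (f \o g) @` [set: nat] #= [set: nat].
    by apply: inj_card_eq => i j _ _ /= e; apply: g_inj; apply: f_inj e.
  by rewrite card_eq_le => /andP[].
pose B := (f \o double) @` [set: nat]; exists B; split.
- by move=> _ [i _ <-]; apply: fA.
- by apply: inf_im; apply: double_inj.
apply: sub_infinite_set (inf_im (fun i => i.*2.+1) _); last first.
  by move=> i j [] /double_inj.
move=> _ [i _ <-]; split; first exact: fA.
by move=> [j _ /= /f_inj e]; have := e I I; lia.
Qed.

End CardSeq.

Section PowersetModel.
Variable I : Type.
Local Open Scope classical_set_scope.
Local Open Scope card_scope.
Implicit Types (A B : set I).
Local Notation P := (Powerset I).

Lemma powerset_atom (a : P) : atom a <-> exists x, a = [set x].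
Proof.
split=> [[a0 min_a]|[x ->]].
  have [x ax] : exists x, a x by apply/set0P/eqP.
  exists x; have [|/eqP|->//] := min_a [set x].
    by apply/setIidPl => _ ->.
  by rewrite -[_ == _]/([set x] == set0 :> set I) => /eqP/(congr1 (@^~ x));
    rewrite propeqE => -[/(_ erefl)].
split; first by move/(congr1 (@^~ x)); rewrite propeqE => -[/(_ erefl)].
move=> b /setIidPl bx; case: (EM (b x)) => b_x; [right|left].
  by rewrite predeqE => y; split=> [/bx//|->].
by rewrite predeqE => y; split=> [/[dup] /bx ->|].
Qed.

Lemma powerset_at_least n (A : P) : at_least n A <-> `I_n #<= A.
Proof.
pose f (x : {classic I}) : {classic set I} := [set x].
have f_inj : injective f.
  by move=> x y /(congr1 (@^~ x)); rewrite propeqE => -[/(_ erefl)].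
rewrite (@card_le_seqP {classic I}); split=> [[s [us <- hs]]|[s [us <- hs]]].
  have [s' def_s] : exists s', s = map f s'.
    elim: s hs {us} => [|a s IHs] hs; first by exists [::].
    have [|s' ->] := IHs; first by move=> b bs; apply: hs; rewrite inE bs orbT.
    have [/powerset_atom[x ->] _] := hs a (mem_head _ _).
    by exists (x :: s').
  exists s'; rewrite def_s in us hs *; split; first exact: map_uniq us.
    by rewrite size_map.
  by move=> x xs'; have [_ /setIidPl] := hs _ (map_f f xs'); apply.
exists (map f s); split; [by rewrite map_inj_uniq|exact: size_map|].
move=> _ /mapP[x /hs Ax ->]; split; first by apply/powerset_atom; exists x.
by apply/setIidPl => _ ->.
Qed.

Lemma card_eq_uniq A k l : A #= `I_k -> A #= `I_l -> k = l.
Proof.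
by move=> Ak Al; apply/(@card_eq_II _ _); apply: card_eq_trans Al;
  rewrite card_eq_sym.
Qed.

Lemma powerset_split A B k : A `&` B = set0 -> A `|` B #= `I_k ->
  exists i j, [/\ A #= `I_i, B #= `I_j & k = i + j].
Proof.
move=> dAB cAB; have fAB : finite_set (A `|` B) by apply/finite_setP; exists k.
have /finite_setP[i ci] : finite_set A.
  by apply: sub_finite_set fAB; apply: subsetUl.
have /finite_setP[j cj] : finite_set B.
  by apply: sub_finite_set fAB; apply: subsetUr.
exists i, j; split=> //; apply: card_eq_uniq cAB _.
exact: (@card_eq_disjointU {classic I}).
Qed.

Lemma powerset_models : infinite_set [set: I] -> models P T3.
Proof.
move=> infI _ []; try by move=> v x y z; first [exact: setIA|exact:
  setUA|exact: setIUr|exact: setUIr].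
- by move=> v x y; apply: setIC.
- by move=> v x y; apply: setUC.
- by move=> v x y; rewrite /= setUC setKU.
- by move=> v x y; rewrite /= setIC setKI.
- by move=> v x; apply: setICr.
- by move=> v x; apply: setUCr.
- move=> n v; apply/sat_fExs.
  have /infiniteP/card_le_inj[|f [_ f_inj]] := infI; first by exists 0.
  exists (fun j => [set f j]); apply/sat_fDistinct => j k /andP[ltjk ltkn].
  rewrite !leq0n !add0n ltkn (ltn_trans ltjk ltkn) /= => /(congr1 (@^~ (f j))).
  rewrite propeqE => -[/(_ erefl)/f_inj ejk _].
  by rewrite ejk // ltnn in ltjk.
- move=> v x x0; have [y xy] : exists y, x y by apply/set0P/eqP.
  exists [set y]; split; first by apply/sat_fAtom/powerset_atom; exists y.
  by apply/setIidPl => _ ->.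
- move=> n v x; have := sat_at_least (update v 0 x) n.
  rewrite powerset_at_least => h.
  by split=> /h.
- by move=> v; apply: finite_set0.
- by move=> v x y [fx /setIidPl yx]; apply: sub_finite_set fx.
- by move=> v x y [fx fy]; rewrite /= finite_setU.
- by move=> v fI; apply: infI.
- move=> n v x nC; apply: contrapT => /infiniteP le_x; apply: nC.
  exact: card_le_trans (subset_card_le (@subsetT _ _)) le_x.
- move=> v x /(@infinite_split {classic I})[y [yx infy infxy]].
  exists y; split; first split.
  + by apply/setIidPl.
  + by move=> yx'; apply: infxy; rewrite [y]yx' [X in finite_set X]setDv.
  + by split.
- by move=> n r v x [k [xk _]]; apply/finite_setP; exists k.
- move=> n m r mr v x [/finite_setP[k xk] [Cm nCm]].
  exists k; split=> //; rewrite -mr; congr (_ %% _)%Z; congr Posz.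
  have le_card i : (`I_i #<= x) = (i <= k) by rewrite (card_le_eqr xk)
    card_le_II.
  apply/eqP; rewrite eqn_leq -le_card Cm andbT leqNgt -le_card; apply/negP;
    exact: nCm.
- by move=> n r s rs v x [k [xk kr]]; exists k; rewrite -rs.
- move=> n r s rs v x [k [xk kr]] [l [xl ls]]; apply: rs.
  by rewrite -kr -ls (card_eq_uniq xk xl).
- move=> n m r nm v x [k [xk kr]]; exists k; split=> //.
  have nm' : (Posz n %| Posz m)%Z by [].
  apply/eqP; rewrite eqz_mod_dvd; apply: (dvdz_trans nm').
  by rewrite -eqz_mod_dvd; apply/eqP.
- move=> n v x /finite_setP[k xk]; apply/sat_bigor.
  have n_gt0 : 0 < n := valP n.
  exists (Ordinal (ltn_pmod k n_gt0)) => //; exists k; split=> //=.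
  by rewrite -modz_nat modz_mod.
- move=> n r s v x y [xy [[k [xk kr]] [l [yl ls]]]]; exists (k + l); split.
    exact: (@card_eq_disjointU {classic I}).
  by rewrite PoszD -modzDm kr ls modzDm.
move=> n r v x y [xy [k [xyk kr]]].
have [i [j [xi yj kij]]] := powerset_split xy xyk.
have n_gt0 : 0 < n := valP n.
apply/sat_bigor; exists (Ordinal (ltn_pmod i n_gt0)) => //.
apply/sat_bigor; exists (Ordinal (ltn_pmod j n_gt0)).
  by rewrite /= -kr kij; apply/eqP; rewrite !modz_nat modnDm.
split; [exists i|exists j]; split=> //=; by rewrite -modz_nat modz_mod.
Qed.

End PowersetModel.

(** * Decidability *)

Lemma code_inj : injective CodeSeq.code.
Proof. exact: can_inj CodeSeq.codeK. Qed.

Lemma goedel_int_inj : injective goedel_int.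
Proof. by move=> [k|k] [l|l] /code_inj // [->]. Qed.

Lemma goedel_term_inj : injective goedel_term.
Proof.
elim=> [i|||t IHt u IHu|t IHt u IHu|t IHt] [j|||t' u'|t' u'|t'] /code_inj //.
- by move=> [->].
- by move=> [/IHt-> /IHu->].
- by move=> [/IHt-> /IHu->].
- by move=> [/IHt->].
Qed.

Lemma posnat_inj (n m : posnat) : posnat_val n = posnat_val m -> n = m.
Proof. exact: val_inj. Qed.

Lemma goedel_inj : injective goedel.
Proof.
elim=> [|t u|n t|t|n r t|a IHa b IHb|a IHa b IHb|a IHa b IHb|i a IHa|i a IHa]
  [|t' u'|n' t'|t'|n' r' t'|a' b'|a' b'|a' b'|i' a'|i' a'] /code_inj //.
- by move=> [/goedel_term_inj-> /goedel_term_inj->].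
- by move=> [/posnat_inj-> /goedel_term_inj->].
- by move=> [/goedel_term_inj->].
- by move=> [/posnat_inj-> /goedel_int_inj-> /goedel_term_inj->].
- by move=> [/IHa-> /IHb->].
- by move=> [/IHa-> /IHb->].
- by move=> [/IHa-> /IHb->].
- by move=> [-> /IHa->].
- by move=> [-> /IHa->].
Qed.

Lemma code_eq s t : (CodeSeq.code s == CodeSeq.code t) = (s == t).
Proof. exact: (inj_eq code_inj). Qed.

Lemma code_nth_lt s i : i < size s -> nth 0 s i < CodeSeq.code s.
Proof. exact: (all_nthP 0 (CodeSeq.ltn_code s)). Qed.

Lemma nat_of_bool_neq0 (b : bool) : (nat_of_bool b != 0) = b.
Proof. by case: b. Qed.

Arguments CodeSeq.code : simpl never.

(* [term_code n 0] says that [n] codes a term, and [term_code n i.+1] that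
   moreover the variable [i] does not occur in it; likewise [formula_code]. *)
Definition term_avoids s t : bool := if s is i.+1 then ~~ occurs i t else true.
Definition formula_avoids s a : bool := if s is i.+1 then ~~ free_in i a else
  true.

Definition term_code n s := `[< exists t, n = goedel_term t /\ term_avoids s t
  >].
Definition formula_code n s := `[< exists a, n = goedel a /\ formula_avoids s a
  >].

Definition is_node (n : nat) (s : seq nat) : bool := n == CodeSeq.code s.

(** The entries of [n] after its tag are the candidate children, consulted through [h]. Avoiding
    variable [i] is encoded by [s = i.+1], whence the shift in the variable case. *)
Definition term_code_step n s (h : nat -> nat -> nat) : bool :=
  [|| is_node n [:: 0; nthc n 1] && (s != (nthc n 1).+1),
      is_node n [:: 1],
      is_node n [:: 2],
      is_node n [:: 3; nthc n 1; nthc n 2] && ((h (nthc n 1) s != 0) && (h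
        (nthc n 2) s != 0)),
      is_node n [:: 4; nthc n 1; nthc n 2] && ((h (nthc n 1) s != 0) && (h
        (nthc n 2) s != 0))
    | is_node n [:: 5; nthc n 1] && (h (nthc n 1) s != 0)].

Lemma nthc_lt n s i : n = CodeSeq.code s -> i < size s -> nthc n i < n.
Proof. by move=> ->; rewrite nthc_code; apply: code_nth_lt. Qed.

Lemma term_code_goedel t s : term_code (goedel_term t) s = term_avoids s t.
Proof.
by apply/asboolP/idP => [[t' [/goedel_term_inj->]]|ts] //; exists t.
Qed.

Lemma formula_code_goedel a s : formula_code (goedel a) s = formula_avoids s a.
Proof. by apply/asboolP/idP => [[a' [/goedel_inj->]]|ts] //; exists a. Qed.

Lemma term_code_stepE n s (h : nat -> nat -> nat) :
  (forall n', n' < n -> h n' s = term_code n' s) ->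
  term_code_step n s h = term_code n s.
Proof.
move=> hE.
have hlt i u : nthc n i < n -> nthc n i = goedel_term u -> (h (nthc n i) s !=
  0) = term_avoids s u.
  by move=> lt eq; rewrite hE // nat_of_bool_neq0 eq term_code_goedel.
have avoidsM op t u : (op = tMeet) \/ (op = tJoin) ->
    term_avoids s (op t u) = term_avoids s t && term_avoids s u.
  by case=> ->; case: (s) => //= i; rewrite negb_or.
apply/idP/asboolP => [|[t [def_n ns]]]; last first.
  have at_node s' i : n = CodeSeq.code s' -> i < size s' ->
      nthc n i = nth 0 s' i /\ nthc n i < n.
    by move=> -> lti; rewrite nthc_code; split=> //; apply: code_nth_lt.
  rewrite /term_code_step.
  case: t def_n ns => [i|||t u|t u|t] /[dup] def_n /at_node node.
  - have [-> _] := node 1 isT; rewrite def_n /is_node !code_eq /= eqxx /=.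
    by case: (s) => //= k; rewrite eqSS eq_sym => ->.
  - by rewrite def_n /is_node !code_eq.
  - by rewrite def_n /is_node !code_eq orbT.
  - have [e1 l1] := node 1 isT; have [e2 l2] := node 2 isT.
    rewrite avoidsM; last by left.
    by rewrite -(hlt _ _ l1 e1) -(hlt _ _ l2 e2) => ->;
      rewrite e1 e2 /is_node def_n eqxx !orbT.
  - have [e1 l1] := node 1 isT; have [e2 l2] := node 2 isT.
    rewrite avoidsM; last by right.
    by rewrite -(hlt _ _ l1 e1) -(hlt _ _ l2 e2) => ->;
      rewrite e1 e2 /is_node def_n eqxx !orbT.
  - have [e1 l1] := node 1 isT.
    have -> : term_avoids s (tCompl t) = term_avoids s t by [].
    by rewrite -(hlt _ _ l1 e1) => ->; rewrite e1 /is_node def_n eqxx !orbT.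
have hT s' i : n = CodeSeq.code s' -> i < size s' -> h (nthc n i) s != 0 ->
    exists2 t, nthc n i = goedel_term t & term_avoids s t.
  move=> def_n lti; rewrite hE ?(nthc_lt def_n) // nat_of_bool_neq0.
  by case/asboolP=> t [-> ts]; exists t.
rewrite /term_code_step /is_node.
case/orP=> [/andP[/eqP def_n sx]|].
  exists (tVar (nthc n 1)); split=> //.
  by case: (s) sx => //= k; rewrite eqSS eq_sym.
case/orP=> [/eqP def_n|]; first by exists tZero; case: (s).
case/orP=> [/eqP def_n|]; first by exists tOne; case: (s).
case/orP=> [/andP[/eqP def_n /andP[/(hT _ 1 def_n isT)[t e1 ts] /(hT _ 2 def_n
  isT)[u e2 us]]]|].
  exists (tMeet t u); rewrite avoidsM ?ts ?us; last by left.
  by split=> //; rewrite def_n e1 e2.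
case/orP=> [/andP[/eqP def_n /andP[/(hT _ 1 def_n isT)[t e1 ts] /(hT _ 2 def_n
  isT)[u e2 us]]]|].
  exists (tJoin t u); rewrite avoidsM ?ts ?us; last by right.
  by split=> //; rewrite def_n e1 e2.
case/andP=> [/eqP def_n /(hT _ 1 def_n isT)[t e1 ts]].
by exists (tCompl t); split=> //; rewrite def_n e1.
Qed.

Lemma rec_term_code : rec2 (fun n s => nat_of_bool (term_code n s)).
Proof.
apply: (@env_rec_table (fun n s _ => nat_of_bool (term_code n s))
  (fun n s h _ => nat_of_bool (term_code_step n s h)) (fun e => (e 1).+1) (fun
    e => e 0) (fun e => e 1)).
- by env_rec.
- by env_rec.
- by env_rec.
- by [].
- by rewrite /term_code_step /is_node; env_rec.
by move=> n s h e lts hE; rewrite term_code_stepE // => n' ltn; apply: hE.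
Qed.

#[local] Hint Resolve rec_term_code : env_rec.

Definition int_code c : bool := is_node c [:: 0; nthc c 1] || is_node c [:: 1;
  nthc c 1].

Lemma int_codeP c : int_code c <-> exists r, c = goedel_int r.
Proof.
split=> [/orP[]/eqP->|[[k|k] ->]].
- by exists (Posz (nthc c 1)).
- by exists (Negz (nthc c 1)).
- by rewrite /int_code /is_node /= nthc_code eqxx.
- by rewrite /int_code /is_node /= nthc_code eqxx orbT.
Qed.

(** A quantifier binding the variable avoided frees it from the test on the body, which must still
    code a formula: this is the query at [0], and the table needs second arguments up to [s]. *)
Definition formula_code_step n s (h : nat -> nat -> nat) : bool :=
  [|| is_node n [:: 0],
      is_node n [:: 1; nthc n 1; nthc n 2] &&
        (term_code (nthc n 1) s && term_code (nthc n 2) s),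
      is_node n [:: 2; nthc n 1; nthc n 2] &&
        ((0 < nthc n 1) && term_code (nthc n 2) s),
      is_node n [:: 3; nthc n 1] && term_code (nthc n 1) s,
      is_node n [:: 4; nthc n 1; nthc n 2; nthc n 3] &&
        ((0 < nthc n 1) && (int_code (nthc n 2) && term_code (nthc n 3) s)),
      is_node n [:: 5; nthc n 1; nthc n 2] &&
        ((h (nthc n 1) s != 0) && (h (nthc n 2) s != 0)),
      is_node n [:: 6; nthc n 1; nthc n 2] &&
        ((h (nthc n 1) s != 0) && (h (nthc n 2) s != 0)),
      is_node n [:: 7; nthc n 1; nthc n 2] &&
        ((h (nthc n 1) s != 0) && (h (nthc n 2) s != 0)),
      is_node n [:: 8; nthc n 1; nthc n 2] &&
        ((h (nthc n 2) 0 != 0) && ((s == (nthc n 1).+1) || (h (nthc n 2) s !=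
          0)))
    | is_node n [:: 9; nthc n 1; nthc n 2] &&
        ((h (nthc n 2) 0 != 0) && ((s == (nthc n 1).+1) || (h (nthc n 2) s !=
          0)))].

Lemma formula_code_stepE n s (h : nat -> nat -> nat) :
  (forall n' s', n' < n -> s' <= s -> h n' s' = formula_code n' s') ->
  formula_code_step n s h = formula_code n s.
Proof.
move=> hE.
have hlt i a s' : nthc n i < n -> nthc n i = goedel a -> s' <= s ->
    (h (nthc n i) s' != 0) = formula_avoids s' a.
  by move=> lt eq le; rewrite hE // nat_of_bool_neq0 eq formula_code_goedel.
have avoids2 op a b : [\/ op = fImp, op = fAnd | op = fOr] ->
    formula_avoids s (op a b) = formula_avoids s a && formula_avoids s b.
  by case=> ->; case: (s) => //= i; rewrite negb_or.
have avoidsQ op i a : op = fAll \/ op = fEx ->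
    formula_avoids s (op i a) = (s == i.+1) || formula_avoids s a.
  by case=> ->; case: (s) => //= k; rewrite eqSS negb_and negbK.
apply/idP/asboolP => [|[a [def_n ns]]]; last first.
  have at_node s' i : n = CodeSeq.code s' -> i < size s' ->
      nthc n i = nth 0 s' i /\ nthc n i < n.
    by move=> -> lti; rewrite nthc_code; split=> //; apply: code_nth_lt.
  rewrite /formula_code_step.
  case: a def_n ns => [|t u|k t|t|k r t|a b|a b|a b|i a|i a] /[dup] def_n
    /at_node node.
  - by rewrite def_n /is_node eqxx.
  - have [-> _] := node 1 isT; have [-> _] := node 2 isT => ns.
    have [ts us] : term_avoids s t /\ term_avoids s u.
      by case: (s) ns => //= i; rewrite negb_or => /andP[].
    by rewrite !term_code_goedel ts us /is_node def_n eqxx !orbT.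
  - have [-> _] := node 1 isT; have [-> _] := node 2 isT => ns.
    have k_gt0 : 0 < k := valP k.
    have -> : term_code (goedel_term t) s by rewrite term_code_goedel;
      case: (s) ns.
    by rewrite /= k_gt0 /is_node def_n eqxx !orbT.
  - have [-> _] := node 1 isT => ns.
    have -> : term_code (goedel_term t) s by rewrite term_code_goedel;
      case: (s) ns.
    by rewrite /is_node def_n eqxx !orbT.
  - have [-> _] := node 1 isT; have [-> _] := node 2 isT;
      have [-> _] := node 3 isT => ns.
    have k_gt0 : 0 < k := valP k.
    have -> : term_code (goedel_term t) s by rewrite term_code_goedel;
      case: (s) ns.
    have -> : int_code (goedel_int r) by apply/int_codeP; exists r.
    by rewrite /= k_gt0 /is_node def_n eqxx !orbT.
  1-3: have [e1 l1] := node 1 isT; have [e2 l2] := node 2 isT.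
  1-3: rewrite avoids2; last by [constructor 1|constructor 2|constructor 3].
  1-3: rewrite -(hlt _ _ _ l1 e1 (leqnn s)) -(hlt _ _ _ l2 e2 (leqnn s)) => ->.
  1-3: by rewrite e1 e2 /is_node def_n eqxx !orbT.
  1-2: have [e1 l1] := node 1 isT; have [e2 l2] := node 2 isT.
  1-2: rewrite avoidsQ; last by [left|right].
  1-2: rewrite -(hlt _ _ _ l2 e2 (leqnn s)) (hlt _ _ _ l2 e2 (leq0n s)) => hs.
  1-2: rewrite e1 in hs *; rewrite hs e2 /is_node /=.
  1-2: by rewrite def_n eqxx !orbT.
have hF s' i k : n = CodeSeq.code s' -> i < size s' -> k <= s -> h (nthc n i) k
  != 0 ->
    exists2 a, nthc n i = goedel a & formula_avoids k a.
  move=> def_n lti lek; rewrite hE ?(nthc_lt def_n) // nat_of_bool_neq0.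
  by case/asboolP=> a [-> ts]; exists a.
have tF i : term_code (nthc n i) s -> exists2 t, nthc n i = goedel_term t &
  term_avoids s t.
  by case/asboolP=> t [-> ts]; exists t.
rewrite /formula_code_step /is_node.
case/orP=> [/eqP def_n|]; first by exists fBot; case: (s).
case/orP=> [/andP[/eqP def_n /andP[/tF[t e1 ts] /tF[u e2 us]]]|].
  exists (fEq t u); split; first by rewrite def_n e1 e2.
  by case: (s) ts us => //= i ts us; rewrite negb_or ts us.
case/orP=> [/andP[/eqP def_n /andP[k_gt0 /tF[u e2 us]]]|].
  exists (fC (exist (fun k => 0 < k) _ k_gt0) u); split;
    first by rewrite {1}def_n e2.
  by case: (s) us.
case/orP=> [/andP[/eqP def_n /tF[u e2 us]]|].
  by exists (fFin u); split; [rewrite def_n e2|case: (s) us].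
case/orP=> [/andP[/eqP def_n /andP[k_gt0 /andP[/int_codeP[r er] /tF[u e3
  us]]]]|].
  exists (fRes (exist (fun k => 0 < k) _ k_gt0) r u); split;
    first by rewrite {1}def_n er e3.
  by case: (s) us.
case/orP=> [/andP[/eqP def_n /andP[/(hF _ 1 s def_n isT (leqnn s))[a e1 sa]
  /(hF _ 2 s def_n isT (leqnn s))[b e2 sb]]]|].
  exists (fImp a b); rewrite avoids2 ?sa ?sb; last by constructor 1.
  by split=> //; rewrite def_n e1 e2.
case/orP=> [/andP[/eqP def_n /andP[/(hF _ 1 s def_n isT (leqnn s))[a e1 sa]
  /(hF _ 2 s def_n isT (leqnn s))[b e2 sb]]]|].
  exists (fAnd a b); rewrite avoids2 ?sa ?sb; last by constructor 2.
  by split=> //; rewrite def_n e1 e2.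
case/orP=> [/andP[/eqP def_n /andP[/(hF _ 1 s def_n isT (leqnn s))[a e1 sa]
  /(hF _ 2 s def_n isT (leqnn s))[b e2 sb]]]|].
  exists (fOr a b); rewrite avoids2 ?sa ?sb; last by constructor 3.
  by split=> //; rewrite def_n e1 e2.
have quant_case i : n = CodeSeq.code [:: i; nthc n 1; nthc n 2] ->
    (h (nthc n 2) 0 != 0) && ((s == (nthc n 1).+1) || (h (nthc n 2) s != 0)) ->
    exists2 a, nthc n 2 = goedel a & (s == (nthc n 1).+1) || formula_avoids s a.
  move=> def_n /andP[/(hF _ 2 0 def_n isT (leq0n s))[a e2 _]].
  by rewrite (hlt 2 a s) ?(nthc_lt def_n) //; exists a.
case/orP=> /andP[/eqP def_n /(quant_case _ def_n)[a e2 sa]].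
  exists (fAll (nthc n 1) a); rewrite avoidsQ; last by left.
  by split=> //; rewrite {1}def_n e2.
exists (fEx (nthc n 1) a); rewrite avoidsQ; last by right.
by split=> //; rewrite {1}def_n e2.
Qed.

Lemma rec_formula_code : rec2 (fun n s => nat_of_bool (formula_code n s)).
Proof.
apply: (@env_rec_table (fun n s _ => nat_of_bool (formula_code n s))
  (fun n s h _ => nat_of_bool (formula_code_step n s h)) (fun e => (e 1).+1)
    (fun e => e 0) (fun e => e 1)).
- by env_rec.
- by env_rec.
- by env_rec.
- by [].
- by rewrite /formula_code_step /is_node /int_code /is_node; env_rec.
move=> n s h e lts hE; rewrite formula_code_stepE // => n' s' ltn les;
  apply: hE => //.
exact: leq_ltn_trans les lts.
Qed.

Lemma is_nodeE s s' : is_node (CodeSeq.code s) s' = (s == s').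
Proof. exact: code_eq. Qed.

(** * Recursive evaluation of coded formulas *)

Definition term_val n p := `[< exists t, n = goedel_term t /\ tval p t >].

Lemma term_val_goedel t p : term_val (goedel_term t) p = tval p t.
Proof. by apply/asboolP/idP => [[t' [/goedel_term_inj->]]|tp] //; exists t. Qed.

(** The guard is needed since complement negates its argument, whose value is false also when it
    codes no term. *)
Definition term_val_step n p (h : nat -> nat -> nat) : bool :=
  term_code n 0 &&
  [|| is_node n [:: 0; nthc n 1] && bit (nthc n 1) p,
      is_node n [:: 2],
      is_node n [:: 3; nthc n 1; nthc n 2] && ((h (nthc n 1) p != 0) && (h
        (nthc n 2) p != 0)),
      is_node n [:: 4; nthc n 1; nthc n 2] && ((h (nthc n 1) p != 0) || (h
        (nthc n 2) p != 0))
    | is_node n [:: 5; nthc n 1] && ~~ (h (nthc n 1) p != 0)].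

Lemma term_val_stepE n p (h : nat -> nat -> nat) :
  (forall n', n' < n -> h n' p = term_val n' p) ->
  term_val_step n p h = term_val n p.
Proof.
move=> hE; rewrite /term_val_step; case tn: (term_code n 0); last first.
  symmetry; apply/asboolP => -[t [def_n _]].
  by rewrite def_n term_code_goedel in tn.
move/asboolP: tn => [t [def_n _]].
have hT i u : nthc n i < n -> nthc n i = goedel_term u -> (h (nthc n i) p != 0)
  = tval p u.
  by move=> lt eq; rewrite hE // nat_of_bool_neq0 eq term_val_goedel.
have node s' i : n = CodeSeq.code s' -> i < size s' -> nthc n i = nth 0 s' i /\
  nthc n i < n.
  by move=> -> lti; rewrite nthc_code; split=> //; apply: code_nth_lt.
rewrite [X in _ = X](_ : _ = tval p t); last by rewrite def_n term_val_goedel.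
case: t def_n => [i|||t u|t u|t] /[dup] def_n /node {}node.
- have [-> _] := node 1 isT.
  by rewrite /= in def_n *; rewrite def_n !is_nodeE /= eqxx ?orbF.
- by rewrite /= in def_n *; rewrite def_n !is_nodeE.
- by rewrite /= in def_n *; rewrite def_n !is_nodeE orbT.
- have [e1 l1] := node 1 isT; have [e2 l2] := node 2 isT.
  rewrite (hT _ _ l1 e1) (hT _ _ l2 e2) e1 e2.
  by rewrite /= in def_n *; rewrite def_n !is_nodeE /= eqxx ?orbF.
- have [e1 l1] := node 1 isT; have [e2 l2] := node 2 isT.
  rewrite (hT _ _ l1 e1) (hT _ _ l2 e2) e1 e2.
  by rewrite /= in def_n *; rewrite def_n !is_nodeE /= eqxx ?orbF.
- have [e1 l1] := node 1 isT.
  rewrite (hT _ _ l1 e1) e1.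
  by rewrite /= in def_n *; rewrite def_n !is_nodeE /= eqxx.
Qed.

Lemma rec_bit : rec2 (fun i p => nat_of_bool (bit i p)).
Proof.
apply: env_rec_ext (_ : env_rec (fun e => (e 1 %/ 2 ^ e 0) %% 2));
  last by env_rec.
by move=> e; rewrite bitE.
Qed.

Lemma rec_oadd : rec2 oadd.
Proof.
apply: env_rec_ext (_ : env_rec (fun e =>
  ~~ ((e 0 == 0) || (e 1 == 0)) * (e 0 + e 1).-1)); last by env_rec.
by move=> e; rewrite /oadd; case: ifP => _; rewrite ?mul0n ?mul1n.
Qed.

Lemma rec_max : rec2 maxn.
Proof.
apply: env_rec_ext (_ : env_rec (fun e => e 0 + (e 1 - e 0))); last by env_rec.
by move=> e; rewrite maxnE.
Qed.

#[local] Hint Resolve rec_formula_code rec_bit rec_oadd rec_max : env_rec.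

Lemma rec_precision : rec2 precision.
Proof.
apply: (@env_rec_iteri (fun e => e 1) (fun e => (e 0).+1)
  (fun _ N e => 2 * (N + (e 0)`!))); by env_rec.
Qed.

#[local] Hint Resolve rec_precision : env_rec.

Lemma rec_cell_bound : rec1 cell_bound.
Proof.
by rewrite /rec1 /cell_bound; env_rec.
Qed.

#[local] Hint Resolve rec_cell_bound : env_rec.

Lemma rec_state_bound : rec1 state_bound.
Proof.
by rewrite /rec1 /state_bound; env_rec.
Qed.

#[local] Hint Resolve rec_state_bound : env_rec.

Lemma rec_init_state : rec1 init_state.
Proof.
(* The state is [0] followed by [2 ^ m - 1] ones, which are consed by iteration on codes from the
   empty list, coded by [0]. *)
apply: env_rec_ext (_ : env_rec (fun e => CodeSeq.code (0 ::
    CodeSeq.decode (iteri (2 ^ e 0).-1 (fun _ c => CodeSeq.code (1 ::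
      CodeSeq.decode c)) 0)))).
  move=> e; rewrite /init_state; have : 0 < 2 ^ e 0 by rewrite expn_gt0.
  case: (2 ^ e 0) => // k _; congr CodeSeq.code; rewrite /mkseq /=; congr cons.
  rewrite (iotaDl 1 0) -map_comp.
  elim: k => [//|k IHk]; rewrite [iteri _ _ _]/= CodeSeq.codeK IHk.
  by rewrite [in RHS]/= (iotaDl 1 0) -map_comp; congr cons; apply: eq_map.
have code_decode A : env_rec A -> env_rec (fun e => CodeSeq.code
  (CodeSeq.decode (A e))).
  by apply: env_rec_ext => e; rewrite CodeSeq.decodeK.
apply: env_rec_code_cons; first by env_rec.
apply: (code_decode); apply: env_rec_iteri; [by env_rec|by env_rec|].
by apply: env_rec_code_cons; [env_rec|apply: code_decode; env_rec].
Qed.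

#[local] Hint Resolve rec_init_state : env_rec.

Lemma rec_term_val : rec2 (fun n p => nat_of_bool (term_val n p)).
Proof.
apply: (@env_rec_table (fun n p _ => nat_of_bool (term_val n p))
  (fun n p h _ => nat_of_bool (term_val_step n p h)) (fun e => (e 1).+1) (fun e
    => e 0) (fun e => e 1)).
- by env_rec.
- by env_rec.
- by env_rec.
- by [].
- by rewrite /term_val_step /is_node; env_rec.
by move=> n p h e ltp hE; rewrite term_val_stepE // => n' ltn; apply: hE.
Qed.

#[local] Hint Resolve rec_term_val : env_rec.

(** [osize] on codes, with the conditional written arithmetically so that each summand is visibly
    recursive. *)
Definition code_size m s x : nat :=
  \big[oadd/1]_(p < 2 ^ m) (term_val x p * nthc s p + ~~ term_val x p).

Lemma code_sizeE m s t : code_size m s (goedel_term t) = osize m (nthc s) t.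
Proof.
apply: eq_bigr => p _; rewrite term_val_goedel.
by case: tval; rewrite ?mul1n ?addn0.
Qed.

Lemma rec_code_size : rec3 code_size.
Proof.
apply: (@env_rec_big oadd 1 (fun e => 2 ^ e 0)
  (fun p e => term_val (e 2) p * nthc (e 1) p + ~~ term_val (e 2) p)).
- exact: rec_oadd.
- exact: oaddA.
- exact: oadd1n.
- by move=> k; rewrite oaddC oadd1n.
- by env_rec.
by env_rec.
Qed.

#[local] Hint Resolve rec_code_size : env_rec.

Definition code_congr n c k : bool :=
  is_node c [:: 0; nthc c 1] && (k %% n == nthc c 1 %% n) ||
  is_node c [:: 1; nthc c 1] && ((k + (nthc c 1).+1) %% n == 0).

Lemma code_congrE n r k : code_congr n (goedel_int r) k = int_congr n r k.
Proof.
by case: r => j; rewrite /code_congr /= !nthc_code !is_nodeE /= eqxx ?orbF.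
Qed.

Definition ev_code m n s := `[< exists a, n = goedel a /\ evm m a s >].

Lemma ev_code_goedel m a s : ev_code m (goedel a) s = evm m a s.
Proof. by apply/asboolP/idP => [[a' [/goedel_inj->]]|ea] //; exists a. Qed.

(** The guard keeps implications and universal quantifiers from accepting nodes whose children code
    no formula. A quantifier consults [h] at all states, so states are the second index of the
    table. *)
Definition ev_code_step m n s (h : nat -> nat -> nat) : bool :=
  formula_code n 0 &&
  [|| is_node n [:: 1; nthc n 1; nthc n 2] &&
        all (fun p => (nat_of_bool (term_val (nthc n 1) p) != term_val (nthc n
          2) p) ==>
          (nthc s p == 1)) (iota 0 (2 ^ m)),
      is_node n [:: 2; nthc n 1; nthc n 2] &&
        ((code_size m s (nthc n 2) == 0) || (nthc n 1 < code_size m s (nthc n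
          2))),
      is_node n [:: 3; nthc n 1] && (code_size m s (nthc n 1) != 0),
      is_node n [:: 4; nthc n 1; nthc n 2; nthc n 3] &&
        ((code_size m s (nthc n 3) != 0) &&
         code_congr (nthc n 1) (nthc n 2) (code_size m s (nthc n 3)).-1),
      is_node n [:: 5; nthc n 1; nthc n 2] &&
        ((h (nthc n 1) s != 0) ==> (h (nthc n 2) s != 0)),
      is_node n [:: 6; nthc n 1; nthc n 2] &&
        ((h (nthc n 1) s != 0) && (h (nthc n 2) s != 0)),
      is_node n [:: 7; nthc n 1; nthc n 2] &&
        ((h (nthc n 1) s != 0) || (h (nthc n 2) s != 0)),
      is_node n [:: 8; nthc n 1; nthc n 2] &&
        all (fun s' => upd m (cell_bound m) (nthc n 1) s s' ==> (h (nthc n 2)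
          s' != 0))
          (iota 0 (state_bound m))
    | is_node n [:: 9; nthc n 1; nthc n 2] &&
        has (fun s' => upd m (cell_bound m) (nthc n 1) s s' && (h (nthc n 2) s'
          != 0))
          (iota 0 (state_bound m))].

Lemma ev_code_stepE m n s (h : nat -> nat -> nat) : s < state_bound m ->
  (forall n' s', n' < n -> s' < state_bound m -> h n' s' = ev_code m n' s') ->
  ev_code_step m n s h = ev_code m n s.
Proof.
move=> lts hE; rewrite /ev_code_step; case fn: (formula_code n 0); last first.
  symmetry; apply/asboolP => -[a [def_n _]].
  by rewrite def_n formula_code_goedel in fn.
move/asboolP: fn => [a [def_n _]].
have hT i b s' : nthc n i < n -> nthc n i = goedel b -> s' < state_bound m ->
    (h (nthc n i) s' != 0) = evm m b s'.
  by move=> lt eq ls; rewrite hE // nat_of_bool_neq0 eq ev_code_goedel.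
have node s' i : n = CodeSeq.code s' -> i < size s' -> nthc n i = nth 0 s' i /\
  nthc n i < n.
  by move=> -> lti; rewrite nthc_code; split=> //; apply: code_nth_lt.
rewrite [X in _ = X](_ : _ = evm m a s); last by rewrite def_n ev_code_goedel.
case: a def_n => [|t u|k t|t|k r t|a b|a b|a b|i a|i a] /[dup] def_n /node
  {}node.
- by rewrite /= in def_n *; rewrite def_n !is_nodeE.
- have [-> _] := node 1 isT; have [-> _] := node 2 isT.
  rewrite /= in def_n *; rewrite def_n !is_nodeE /= eqxx ?orbF.
  apply: eq_all => p; rewrite !term_val_goedel.
  by case: (tval p t) (tval p u) => -[].
- have [-> _] := node 1 isT; have [-> _] := node 2 isT.
  rewrite /= in def_n *; rewrite def_n !is_nodeE /= eqxx ?orbF.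
  by rewrite code_sizeE.
- have [-> _] := node 1 isT.
  rewrite /= in def_n *; rewrite def_n !is_nodeE /= eqxx ?orbF.
  by rewrite code_sizeE.
- have [-> _] := node 1 isT; have [-> _] := node 2 isT;
    have [-> _] := node 3 isT.
  rewrite /= in def_n *; rewrite def_n !is_nodeE /= eqxx ?orbF.
  by rewrite code_sizeE code_congrE.
- have [e1 l1] := node 1 isT; have [e2 l2] := node 2 isT.
  rewrite (hT _ _ _ l1 e1 lts) (hT _ _ _ l2 e2 lts) e1 e2.
  by rewrite /= in def_n *; rewrite def_n !is_nodeE /= eqxx ?orbF.
- have [e1 l1] := node 1 isT; have [e2 l2] := node 2 isT.
  rewrite (hT _ _ _ l1 e1 lts) (hT _ _ _ l2 e2 lts) e1 e2.
  by rewrite /= in def_n *; rewrite def_n !is_nodeE /= eqxx ?orbF.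
- have [e1 l1] := node 1 isT; have [e2 l2] := node 2 isT.
  rewrite (hT _ _ _ l1 e1 lts) (hT _ _ _ l2 e2 lts) e1 e2.
  by rewrite /= in def_n *; rewrite def_n !is_nodeE /= eqxx ?orbF.
- have [e1 l1] := node 1 isT; have [e2 l2] := node 2 isT.
  have -> : is_node n [:: 8; nthc n 1; nthc n 2] by rewrite /is_node e1 e2
    def_n.
  have nodeF k r : k != 8 -> is_node n (k :: r) = false.
    by move=> neq; rewrite /= in def_n; rewrite def_n is_nodeE eqseq_cons
      eq_sym (negbTE neq).
  rewrite !nodeF //= orbF e1; apply: eq_in_all => s'; rewrite mem_iota0 => lts'.
  by rewrite (hT _ _ _ l2 e2 lts').
- have [e1 l1] := node 1 isT; have [e2 l2] := node 2 isT.
  have -> : is_node n [:: 9; nthc n 1; nthc n 2] by rewrite /is_node e1 e2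
    def_n.
  have nodeF k r : k != 9 -> is_node n (k :: r) = false.
    by move=> neq; rewrite /= in def_n; rewrite def_n is_nodeE eqseq_cons
      eq_sym (negbTE neq).
  rewrite !nodeF //= e1; apply: eq_in_has => s'; rewrite mem_iota0 => lts'.
  by rewrite (hT _ _ _ l2 e2 lts').
Qed.

Lemma init_state_lt m : init_state m < state_bound m.
Proof.
apply: code_lt_state_bound; first exact: size_mkseq.
apply/allP => _ /mapP[p _ ->]; apply: leq_trans (leq_b1 _) _.
by rewrite muln_gt0 expn_gt0 andbT /cell_bound addn_gt0 fact_gt0 orbT.
Qed.

(** The parameter [m] stays the code of the whole formula, read from the environment, while the
    recursion descends through the codes of subformulas. *)
Lemma rec_ev_code : rec1 (fun n => nat_of_bool (ev_code n n (init_state n))).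
Proof.
apply: (@env_rec_table (fun n s e => nat_of_bool (ev_code (e 0) n s))
  (fun n s h e => nat_of_bool (ev_code_step (e 0) n s h))
  (fun e => state_bound (e 0)) (fun e => e 0) (fun e => init_state (e 0))).
- by env_rec.
- by env_rec.
- by env_rec.
- by move=> e; apply: init_state_lt.
- by rewrite /ev_code_step /code_congr /is_node /upd; env_rec.
by move=> n s h e lts hE; rewrite ev_code_stepE.
Qed.

(** This makes being a sentence a finite test: only variables below the Goedel number can be
    free. *)
Lemma fbounded_free m a i : fbounded m a -> m <= i -> ~~ free_in i a.
Proof.
have tb t : m <= i -> tbounded m t -> ~~ occurs i t.
  move=> le_mi; elim: t => //= [j ltj|t IHt u IHu|t IHt u IHu].
  - by rewrite neq_ltn (leq_trans ltj le_mi) orbT.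
  - by rewrite negb_or => /andP[/IHt-> /IHu->].
  - by rewrite negb_or => /andP[/IHt-> /IHu->].
move=> + le_mi; elim: a => //=.
- by move=> t u /andP[bt bu]; rewrite negb_or !tb.
- by move=> n t /andP[_ /tb->].
- by move=> t /tb->.
- by move=> n r t /andP[_ /tb->].
- by move=> a IHa b IHb /andP[/IHa fa /IHb fb]; rewrite negb_or fa.
- by move=> a IHa b IHb /andP[/IHa fa /IHb fb]; rewrite negb_or fa.
- by move=> a IHa b IHb /andP[/IHa fa /IHb fb]; rewrite negb_or fa.
- by move=> j a IHa /andP[_ /IHa fa]; rewrite negb_and fa orbT.
- by move=> j a IHa /andP[_ /IHa fa]; rewrite negb_and fa orbT.
Qed.

Lemma T3_decidable : decidable_theory T3.
Proof.
pose f n := formula_code n 0 && (all (fun i => formula_code n i.+1) (iota 0 n)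
  &&
  ev_code n n (init_state n)).
have : rec1 (fun n => nat_of_bool (f n)).
  by rewrite /rec1 /f; env_rec; apply: (env_rec_app1 rec_ev_code); env_rec.
have fE n : f n = `[< exists a, [/\ sentence a, entails T3 a & n = goedel a] >].
  apply/idP/asboolP => [|[a [sa Ta ->]]].
    case/andP=> /asboolP[a [-> _]] /andP[/allP ha];
      rewrite ev_code_goedel => ea.
    have [ba da] := bounded_goedel a.
    have sa : sentence a.
      move=> i; case: (ltnP i (goedel a)) => [lti|lei].
        by have := ha i; rewrite mem_iota0 formula_code_goedel => /(_ lti).
      exact: fbounded_free ba lei.
    by exists a; split=> // M M_T3 v; apply/(sentence_ev v M_T3 sa ba da).
  have [ba da] := bounded_goedel a.
  rewrite /f !formula_code_goedel ev_code_goedel /=; apply/andP; split.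
    by apply/allP => i _; rewrite formula_code_goedel; apply: sa.
  (* Consistency enters here: an entailed sentence is true in one actual model, hence accepted by
     [evm]. *)
  have M_T3 := powerset_models infinite_nat.
  pose v : nat -> Powerset nat := fun=> iZero (Powerset nat).
  by apply/(sentence_ev v M_T3 sa ba da); apply: Ta.
move=> [k [g [rg gE]]]; rewrite /decidable_theory /recursive_set.
(* The function of [k] entries becomes unary by putting the argument in entry 0 and zeros
   elsewhere. *)
apply: recursive_ext (recursive_comp (g := fun i v => if i == 0 :> nat then
  thead v else 0) rg _).
  move=> v; rewrite -fE.
  by rewrite (gE (fun i => if i == 0 then thead v else 0)).
case=> -[|i] lti /=; last exact: recursive_zero.
exact: recursive_proj.
Qed.

Theorem theorem3 :
  [/\ complete T3,
      decidable_theory T3,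
      quantifier_elimination T3
    & forall I : Type, infinite_set [set: I]%classic ->
        models (Powerset I) T3 /\
        forall a : formula, sentence a ->
          (entails T3 a <-> holds (Powerset I) a)].
Proof.
split; [split| | |].
- by exists (Powerset nat); apply: powerset_models infinite_nat.
- exact: entails_dichotomy.
- exact: T3_decidable.
- exact: T3_quantifier_elimination.
move=> I infI; have I_T3 := powerset_models infI; split=> // a sa.
split=> [|ha]; first exact.
case: (entails_dichotomy sa) => // na.
by case: (na _ I_T3 (fun=> iZero (Powerset I))); apply: ha.
Qed.
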